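(* Let $d\geq 2$ be a squarefree integer with ${\rm h}(d)=2$ and suppose that one of the following conditions is satisfied: (a) There are distinct primes $p,q$ such that $p\equiv q\equiv 1\mod 4$, $d=pq$ and ${\rm N}(\varepsilon)=-1$. (b) There are primes $p,q$ such that $p\equiv 1\mod 8$, $q\equiv 3\mod 4$, $d=pq$ and $y$ is odd. (c) There are distinct primes $p,q$ such that $p\equiv q\equiv 3\mod 8$ and $d=2pq$. (d) There are primes $p,q$ such that $p\equiv 1\mod 8$, $q\equiv 3\mod 4$, $\left(\frac{p}{q}\right)=-1$ and $d=2pq$. Then $D_d=\emptyset$ if and only if $d\mid y$.
   Context: Let $d\geq 2$ be a squarefree integer, $K=\mathbb{Q}(\sqrt{d})$, and $\mathcal{O}_K$ its ring of algebraic integers. Set $\omega=\sqrt{d}$ and $\mathsf{d}_K=4d$ if $d\equiv 2,3\mod 4$, and $\omega=\frac{1+\sqrt{d}}{2}$ and $\mathsf{d}_K=d$ if $d\equiv 1\mod 4$; then $\mathcal{O}_K=\mathbb{Z}[\omega]$. Let $\varepsilon>1$ be the fundamental unit of $\mathcal{O}_K$ (i.e., the unit group of $\mathcal{O}_K$ is $\{\pm\varepsilon^k:k\in\mathbb{Z}\}$), and let $x,y$ be the unique nonnegative integers with $\varepsilon=x+y\omega$. Let ${\rm N}:K\to\mathbb{Q}$, ${\rm N}(a+b\sqrt{d})=a^2-db^2$ for $a,b\in\mathbb{Q}$, be the norm map. For a positive integer $f$ let $\mathcal{O}_f=\mathbb{Z}+f\mathcal{O}_K$ be the order in $K$ with conductor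 $f$, let ${\rm Pic}(\mathcal{O}_f)$ be its Picard group, and let ${\rm h}(d)=|{\rm Pic}(\mathcal{O}_K)|$ be the class number of $K$. $\left(\frac{a}{b}\right)$ denotes the Kronecker symbol. A prime $p$ is called inert, ramified, split if $\left(\frac{\mathsf{d}_K}{p}\right)=-1,0,1$, respectively. A positive integer $f$ is called an unusual conductor of $d$ if $f$ is squarefree, $f$ is divisible by a ramified prime, $f$ is not divisible by a split prime, ${\rm h}(d)=|{\rm Pic}(\mathcal{O}_f)|=2$, and for each ramified prime $p$ with $p\mid f$ and all $a,b\in\mathbb{Z}$ we have $|pa^2-\frac{\mathsf{d}_K}{p}b^2|\neq 4$. $D_d$ denotes the set of unusual conductors of $d$. *)

(* Defs.v *)
(* MathComp; K = Q(sqrt d) is realized inside algC, and subsets of K are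
   [set algC] in the sense of mathcomp.classical. *)
From HB Require Import structures.
From mathcomp Require Import all_boot all_order all_algebra all_field.
From mathcomp Require Import boolp classical_sets functions cardinality.

Set Implicit Arguments.
Unset Strict Implicit.
Unset Printing Implicit Defensive.

Import Order.TTheory GRing.Theory Num.Theory.

Local Open Scope classical_set_scope.
Local Open Scope card_scope.
Local Open Scope ring_scope.

Definition squarefree (n : nat) : Prop :=
  forall p : nat, prime p -> ~~ (p ^ 2 %| n)%N.

(* (a/p) for p prime: the Legendre symbol if p is odd, and for p = 2
   the value is 0, 1, -1 if a is even, a = +-1 mod 8, a = +-3 mod 8. *)
Definition kronecker_prime (a : int) (p : nat) : int :=
  if (p%:Z %| a)%Z then 0
  else if p == 2%N then
    (if (a == 1 %[mod 8])%Z || (a == - 1 %[mod 8])%Z then 1 else - 1)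
  else if [exists x : 'I_p, ((x%:Z) ^+ 2 == a %[mod p%:Z])%Z] then 1
  else - 1.

(* (a/0) = [|a| = 1]; (a/-1) = -1 iff a < 0; multiplicative in b. *)
Definition kronecker (a b : int) : int :=
  if b == 0 then (`|a| == 1)%:R
  else (if (a < 0) && (b < 0) then - 1 else 1) *
       \prod_(u <- prime_decomp `|b|%N) kronecker_prime a u.1 ^+ u.2.

Section QuadraticField.

Variable d : nat.

Definition quad_field : set algC :=
  [set z | exists a b : rat, z = ratr a + ratr b * sqrtC d%:R].

(* The subset of K of elements integral over Z; [Aint] is the set of all
   algebraic integers of algC. *)
Definition quad_int : set algC := [set z | quad_field z /\ z \in Aint].

Definition omega : algC :=
  if (d %% 4 == 1)%N then (1 + sqrtC d%:R) / 2 else sqrtC d%:R.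

Definition disc : nat := if (d %% 4 == 1)%N then d else (4 * d)%N.

(* N(a + b sqrt d) = a^2 - d b^2. The coordinates a, b are unique when d is
   not a square; the value outside K is the dummy 0. *)
Definition normK (z : algC) : rat :=
  xget 0 [set n | exists a b : rat,
    z = ratr a + ratr b * sqrtC d%:R /\ n = a ^+ 2 - d%:R * b ^+ 2].

Definition quad_order (f : nat) : set algC :=
  [set z | exists (m : int) (w : algC), quad_int w /\ z = m%:~R + f%:R * w].

Definition quad_unit (z : algC) : Prop :=
  quad_int z /\ exists2 w, quad_int w & z * w = 1.

(* The order on algC is partial: [1 < e] includes that e is real. *)
Definition fundamental_unit (e : algC) : Prop :=
  1 < e /\ forall z : algC,
    quad_unit z <-> exists k : int, z = e ^ k \/ z = - e ^ k.

Definition fractional_ideal (O I : set algC) : Prop :=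
  [/\ I `<=` quad_field,
      exists2 z, I z & z != 0,
      forall u v, I u -> I v -> I (u + v),
      forall a u, O a -> I u -> I (a * u)
    & exists c, [/\ O c, c != 0 & forall u, I u -> O (c * u)]].

Definition ideal_mul (I J : set algC) : set algC :=
  [set z | exists (n : nat) (u v : 'I_n -> algC),
    (forall i, I (u i) /\ J (v i)) /\ z = \sum_(i < n) u i * v i].

Definition invertible_ideal (O I : set algC) : Prop :=
  fractional_ideal O I /\
  exists2 J, fractional_ideal O J & ideal_mul I J = O.

(* The coset of I modulo the principal ideals aO, a in K^*:
   (aO)I = aI for an O-module I. *)
Definition ideal_class (I : set algC) : set (set algC) :=
  [set J | exists a, [/\ quad_field a, a != 0 & J = [set a * z | z in I]]].

(* The underlying set of the Picard group of the order O. *)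
Definition Pic (O : set algC) : set (set (set algC)) :=
  [set ideal_class I | I in invertible_ideal O].

Definition ramified (p : nat) : Prop := prime p /\ kronecker disc p = 0.
Definition splits (p : nat) : Prop := prime p /\ kronecker disc p = 1.

(* disc / p is an exact division, as p ramified means that p divides disc. *)
Definition unusual_conductor (f : nat) : Prop :=
  [/\ (0 < f)%N /\ squarefree f,
      exists2 p, ramified p & (p %| f)%N,
      forall p, splits p -> ~~ (p %| f)%N,
      Pic quad_int #= `I_2 /\ Pic (quad_order f) #= `I_2
    & forall p, ramified p -> (p %| f)%N -> forall a b : int,
        `|p%:Z * a ^+ 2 - (disc %/ p)%N%:Z * b ^+ 2| != 4].

Definition unusual_conductors : set nat := [set f | unusual_conductor f].

End QuadraticField.

(* Main.v *)
(* If an odd ramified prime r divides y, then every unit of O_K lies in O_r, and for r | f the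
   ideals (1 + k (f/r) sqrt d) O_f + f O_K, k = 0, 1, 2, lie in three distinct classes of
   Pic(O_f), so |Pic(O_f)| is not 2.  If r does not divide y, the powers of eps run through
   all lines of O_K / r O_K other than the nilpotent one, so an invertible ideal of O_r is
   principal as soon as its extension to O_K is, and Pic(O_r) embeds into Pic(O_K).  The other
   odd prime r' | d gives a nonprincipal ideal of O_r, because r' times a unit is never a
   square in K; for the same reason p a^2 - (d_K/p) b^2 = +-4 is unsolvable for p = r.  So r
   is an unusual conductor.

   In case (a) N(eps) = -1 shows that r' times a unit is not a square.  In the cases (b), (c),
   (d), one of 2, -2 is a square modulo m = pq, so Thue's lemma gives X^2 - d = +-2 Z^2.  The
   square of the ideal J = (Z, X + sqrt d) is principal as h(d) = 2, and it divides X + sqrt d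
   with a cofactor of norm +-2.  Hence the prime above 2 is principal, which rules out the
   ramified prime 2, and 2 times an odd power of eps is a square in K; so r' times a unit
   cannot be one, as 2 r' is not. *)

Require Import Defs.
From HB Require Import structures.
From mathcomp Require Import all_boot all_order all_algebra all_field.
From mathcomp Require Import boolp classical_sets functions cardinality.
From mathcomp Require Import ring lra zify.

Set Implicit Arguments.
Unset Strict Implicit.
Unset Printing Implicit Defensive.

Import Order.TTheory GRing.Theory Num.Theory.

Local Open Scope classical_set_scope.
Local Open Scope card_scope.
Local Open Scope ring_scope.

(** Why squares decide principality: if r' divides d and an ideal with square (r') has a generator
    g, then g^2 is r' times a unit. As K is real this unit is positive, hence a power of eps, and
    only the parity of its exponent matters, since even powers can be absorbed into g. Either odd
    prime of d may take the role of r, with the other one as r', so both of them must be shown to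
    have no unit multiple that is a square.

    Emptiness of D_d only forces the odd primes of d to divide y. When d = 2pq, the divisibility of
    y by 2 needs an argument of its own: a square of the form 2 eps^l excludes N(eps) = -1, and x^2
    - d y^2 = 1 with y odd is impossible modulo 4.

    Picard groups are bare sets of classes here. Statements about a group of order 2 are obtained by
    comparing three explicit invertible ideals, two of which must be homothetic. *)

Lemma rat_sqr_nat (q : rat) (n : nat) : q ^+ 2 = n%:R -> exists s, n = (s ^ 2)%N.
Proof.
move=> q2.
have q2C : (ratr q : algC) ^+ 2 = n%:R by rewrite -rmorphXn q2 rmorph_nat.
have /Cint_rat_Aint : (ratr q : algC) \in Crat by apply: Crat_rat.
have qA : (ratr q : algC) \in Aint.
  apply: (@root_monic_Aint ('X^2 - n%:R%:P)).
  - by rewrite rootE !hornerE q2C subrr.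
  - exact: monicXnsubC.
  - by rewrite polyOverXnsubC rpred_nat.
move=> /(_ qA) /intrP[z zE]; exists `|z|%N.
have: n%:Z = z ^+ 2 by apply: (@intr_inj algC); rewrite rmorphXn /= -zE q2C.
by move/(congr1 absz); rewrite abszX.
Qed.

Lemma squarefree_sqr_dvd (n m : nat) : squarefree n -> (m ^ 2 %| n)%N -> (0 < n)%N -> m = 1%N.
Proof.
move=> sqf mn n0; have [m1|m1|->//] := ssrnat.ltngtP m 1.
  by move: mn n0; rewrite (_ : m = 0%N); [rewrite dvd0n => /eqP -> | lia].
have [p pp pm] := pdivP m1.
by have /negP[] := sqf p pp; apply: dvdn_trans mn; rewrite dvdn_exp2r.
Qed.

(** * Integers of the quadratic field *)

Section Quad.

Variable d : nat.
Hypothesis d_ge2 : (2 <= d)%N.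
Hypothesis d_sqf : squarefree d.

Local Notation sd := (sqrtC (d%:R : algC)).
Local Notation O := (quad_int d).

Lemma sdE : sd ^+ 2 = d%:R. Proof. exact: sqrtCK. Qed.

Lemma sd_mul : sd * sd = d%:R. Proof. by rewrite -expr2 sdE. Qed.

(** Trades d for s^2, so that identities in K become polynomial identities within reach of
    [ring]. *)
Ltac sdE_subst := move: sdE; move: (sqrtC (d%:R : algC)) => s <-.

Lemma d_nonsquare (q : rat) : q ^+ 2 <> d%:R.
Proof.
move=> /rat_sqr_nat[s ds].
have s1 : s = 1%N by apply: (squarefree_sqr_dvd d_sqf); [rewrite ds|lia].
by move: d_ge2; rewrite ds s1.
Qed.

Lemma sd_free (a b : rat) : ratr a + ratr b * sd = 0 -> a = 0 /\ b = 0.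
Proof.
have [->|b0] := eqVneq b 0.
  by rewrite rmorph0 mul0r addr0 => /eqP; rewrite fmorph_eq0 => /eqP.
move=> /eqP; rewrite addr_eq0 => /eqP e.
case: (@d_nonsquare (a / b)); apply: (fmorph_inj (ratr : {rmorphism rat -> algC})).
rewrite rmorphXn /= fmorph_div/= e -mulNr mulrC mulNr mulrN mulKf ?fmorph_eq0//.
by rewrite sqrrN sdE rmorph_nat.
Qed.

Lemma sd_inj (a b a' b' : rat) :
  ratr a + ratr b * sd = ratr a' + ratr b' * sd -> a = a' /\ b = b'.
Proof.
move=> e; have [] := @sd_free (a - a') (b - b').
  by rewrite !rmorphB /= mulrBl addrACA e -opprD subrr.
by move=> /eqP; rewrite subr_eq0 => /eqP-> /eqP; rewrite subr_eq0 => /eqP.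
Qed.

Lemma normKE (a b : rat) : normK d (ratr a + ratr b * sd) = a ^+ 2 - d%:R * b ^+ 2.
Proof.
rewrite /normK; case: xgetP => [_ -> [a' [b' [/sd_inj[-> ->] ->]]]//|].
by move=> /(_ (a ^+ 2 - d%:R * b ^+ 2)) /= []; exists a, b.
Qed.

Lemma quad_fieldM u v : quad_field d u -> quad_field d v -> quad_field d (u * v).
Proof.
move=> [a [b ->]] [a' [b' ->]].
exists (a * a' + d%:R * b * b'), (a * b' + a' * b).
rewrite !(rmorphD, rmorphM, rmorph_nat) /=; sdE_subst; ring.
Qed.

Lemma normKM u v : quad_field d u -> quad_field d v ->
  normK d (u * v) = normK d u * normK d v.
Proof.
move=> [a [b ->]] [a' [b' ->]].
have -> : (ratr a + ratr b * sd) * (ratr a' + ratr b' * sd) =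
   ratr (a * a' + d%:R * b * b') + ratr (a * b' + a' * b) * sd.
  rewrite !(rmorphD, rmorphM, rmorph_nat) /=; sdE_subst; ring.
by rewrite !normKE; ring.
Qed.

Lemma quad_fieldD u v : quad_field d u -> quad_field d v -> quad_field d (u + v).
Proof.
move=> [a [b ->]] [a' [b' ->]]; exists (a + a'), (b + b').
rewrite !rmorphD /=; ring.
Qed.

Lemma quad_field_rat a : quad_field d (ratr a).
Proof. by exists a, 0; rewrite rmorph0 mul0r addr0. Qed.

Lemma quad_field_int (m : int) : quad_field d m%:~R.
Proof. by have := quad_field_rat m%:~R; rewrite ratr_int. Qed.

Lemma quad_field_nat (m : nat) : quad_field d m%:R.
Proof. exact: (quad_field_int m%:Z). Qed.

Lemma quad_field_sd : quad_field d sd.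
Proof. by exists 0, 1; rewrite rmorph0 rmorph1 mul1r add0r. Qed.

Lemma quad_fieldN u : quad_field d u -> quad_field d (- u).
Proof. by move=> uK; rewrite -mulN1r; apply: quad_fieldM => //; apply: (quad_field_int (-1)). Qed.

Lemma quad_fieldV u : quad_field d u -> quad_field d u^-1.
Proof.
move=> [a [b ->]]; set n := a ^+ 2 - d%:R * b ^+ 2.
(* As d is not a rational square, the norm vanishes only at 0, where the convention 0^-1 = 0
   applies. *)
have [n0|n0] := eqVneq n 0.
  have [a0 b0] : a = 0 /\ b = 0.
    have [b0|b0] := eqVneq b 0.
      by move: n0; rewrite /n b0 expr0n mulr0 subr0 => /eqP; rewrite sqrf_eq0 => /eqP.
    case: (@d_nonsquare (a / b)); move/eqP: n0; rewrite subr_eq0 => /eqP n0.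
    by rewrite expr_div_n n0 mulfK // sqrf_eq0.
  by rewrite a0 b0 rmorph0 mul0r addr0 invr0; apply: (quad_field_int 0).
exists (a / n), (- b / n); apply: (@mulfI _ (ratr n)); first by rewrite fmorph_eq0.
have un : (ratr a + ratr b * sd) * (ratr a - ratr b * sd) = (ratr n : algC).
  rewrite /n !(rmorphB, rmorphXn, rmorphM, rmorph_nat) /=; sdE_subst; ring.
have u0 : ratr a + ratr b * sd != 0 :> algC.
  by apply/eqP => u0; move/eqP: un; rewrite u0 mul0r eq_sym fmorph_eq0 (negPf n0).
rewrite -{1}un mulrAC divff // mul1r !fmorph_div/= rmorphN/=.
by field; rewrite fmorph_eq0.
Qed.

Lemma sd_int : O sd.
Proof.
split; first exact: quad_field_sd.
apply: (@root_monic_Aint ('X^2 - d%:R%:P)).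
- by rewrite rootE !hornerE sdE subrr.
- exact: monicXnsubC.
- by rewrite polyOverXnsubC rpred_nat.
Qed.

Lemma quad_intM u v : O u -> O v -> O (u * v).
Proof. by move=> [uK uA] [vK vA]; split; [apply: quad_fieldM|apply: rpredM]. Qed.

Lemma quad_intD u v : O u -> O v -> O (u + v).
Proof. by move=> [uK uA] [vK vA]; split; [apply: quad_fieldD|apply: rpredD]. Qed.

Lemma quad_intN u : O u -> O (- u).
Proof. by move=> [uK uA]; split; [apply: quad_fieldN|rewrite rpredN]. Qed.

Lemma quad_int_int (m : int) : O m%:~R.
Proof. by split; [apply: quad_field_int|apply: Aint_int]. Qed.

Lemma quad_int_nat (m : nat) : O m%:R.
Proof. exact: (quad_int_int m%:Z). Qed.

(** Here a is the trace and (a^2 - d b^2)/4 the norm. The arguments are unrestricted, so integrality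
    is always stated apart, as divisibility of a^2 - d b^2 by 4. *)
Definition halfz (a b : int) : algC := (a%:~R + b%:~R * sd) / 2.

Lemma halfz_rat a b : halfz a b = ratr (a%:~R / 2) + ratr (b%:~R / 2) * sd.
Proof. by rewrite /halfz !fmorph_div /= !ratr_int (rmorph_nat _ 2); field. Qed.

Lemma halfz_inj a b a' b' : halfz a b = halfz a' b' -> a = a' /\ b = b'.
Proof.
by rewrite !halfz_rat => /sd_inj[/divIf + /divIf +] => /(_ isT)/intr_inj-> /(_ isT)/intr_inj->.
Qed.

Lemma norm_eqr (R : pzRingType) (a b n : int) : a ^+ 2 - d%:Z * b ^+ 2 = 4 * n ->
  a%:~R ^+ 2 - d%:R * b%:~R ^+ 2 = 4 * n%:~R :> R.
Proof.
by move=> /(congr1 (fun z : int => z%:~R : R)); rewrite /= rmorphB /= rmorphXn rmorphM rmorphXn rmorphM.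
Qed.

Lemma normK_halfz a b n : a ^+ 2 - d%:Z * b ^+ 2 = 4 * n -> normK d (halfz a b) = n%:~R.
Proof.
move=> e; rewrite halfz_rat normKE; apply: (@mulfI _ (4 : rat)) => //.
by rewrite -(norm_eqr _ e); field.
Qed.

Lemma halfz_int a b n : a ^+ 2 - d%:Z * b ^+ 2 = 4 * n -> O (halfz a b).
Proof.
move=> e; split; first by rewrite halfz_rat; do 2 eexists; reflexivity.
(* The characteristic polynomial, with trace a and norm n. *)
apply: (@root_monic_Aint ('X^2 - a%:~R%:P * 'X + n%:~R%:P)).
- have en : n%:~R = (a%:~R ^+ 2 - d%:R * b%:~R ^+ 2) / 4 :> algC.
    by rewrite (norm_eqr _ e); field.
  by rewrite rootE !(hornerD, hornerN, hornerM, hornerXn, hornerX, hornerC) en /halfz;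
    apply/eqP; sdE_subst; field.
- rewrite monicE lead_coefE.
  have -> : size ('X^2 - a%:~R%:P * 'X + n%:~R%:P : {poly algC}) = 3%N.
    rewrite -addrA size_polyDl size_polyXn //.
    rewrite (leq_ltn_trans (size_polyD _ _)) // gtn_max.
    rewrite (leq_ltn_trans (size_polyC_leq1 _)) // andbT size_polyN.
    by rewrite (leq_ltn_trans (size_polyMleq _ _)) // size_polyX size_polyC; case: (_ != _).
  by rewrite /= !(coefD, coefN, coefXn, coefCM, coefX, coefC) /= mulr0 subr0 addr0.
- apply/polyOverP => i; rewrite !(coefD, coefN, coefXn, coefCM, coefX, coefC).
  apply: rpredD; last by case: eqP; rewrite ?rpred_int ?rpred0.
  by rewrite rpredB ?rpredM ?rpred_int ?rpred_nat.
Qed.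

(** The minimal polynomial has rational coefficients, so its values at conjugate points are
    conjugate; if one is 0, so is the other. *)
Lemma Aint_conj (a b : rat) :
  ratr a + ratr b * sd \in Aint -> ratr a - ratr b * sd \in Aint.
Proof.
rewrite {1}/Aint unfold_in.
have [p [pE pm] pr] := minCpolyP (ratr a + ratr b * sd).
move=> pZ; apply: (@root_monic_Aint (minCpoly (ratr a + ratr b * sd))) => //; last first.
  exact: minCpoly_monic.
have: root (minCpoly (ratr a + ratr b * sd)) (ratr a + ratr b * sd) by apply: root_minCpoly.
rewrite pE !rootE => /eqP r0; apply/eqP.
have [A [B [eA eB]]] : exists A B : rat,
    (map_poly ratr p).[ratr a + ratr b * sd] = ratr A + ratr B * sd /\
    (map_poly ratr p).[ratr a - ratr b * sd] = ratr A - ratr B * sd.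
  elim/poly_ind: p {pE pm pr r0} => [|q c [A [B [eA eB]]]].
    by exists 0, 0; rewrite !rmorph0 !horner0; split; ring.
  exists (A * a + d%:R * B * b + c), (A * b + B * a).
  rewrite rmorphD rmorphM /= map_polyX map_polyC !hornerMXaddC eA eB !(rmorphD, rmorphM) /=.
  by rewrite (rmorph_nat _ d); sdE_subst; split; ring.
move: r0; rewrite eA eB => /sd_free[-> ->]; rewrite !rmorph0; ring.
Qed.

(* The half-integral coordinates make the description uniform in d mod 4. *)
Lemma quad_intP z : O z <->
  exists a b n, z = halfz a b /\ a ^+ 2 - d%:Z * b ^+ 2 = 4 * n.
Proof.
split=> [[[a [b ->]] zA]|[a [b [n [-> /halfz_int]]]]//].
have zA' := Aint_conj zA.
have AintQ (q : rat) : (ratr q : algC) \in Aint -> exists m : int, q = m%:~R.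
  move=> /(Cint_rat_Aint (Crat_rat q)) /intrP[m qm]; exists m.
  by apply: (fmorph_inj (ratr : {rmorphism rat -> algC})); rewrite /= qm ratr_int.
have [A eA] : exists m : int, 2 * a = m%:~R.
  apply: AintQ; rewrite rmorphM /= (rmorph_nat _ 2).
  have -> : 2 * ratr a = ratr a + ratr b * sd + (ratr a - ratr b * sd) by ring.
  exact: rpredD.
have [n en] : exists m : int, a ^+ 2 - d%:R * b ^+ 2 = m%:~R.
  apply: AintQ; rewrite !(rmorphB, rmorphXn, rmorphM) /= (rmorph_nat _ d).
  have -> : ratr a ^+ 2 - d%:R * ratr b ^+ 2 = (ratr a + ratr b * sd) * (ratr a - ratr b * sd).
    by sdE_subst; ring.
  exact: rpredM.
set c := 2 * b; have ec : d%:R * c ^+ 2 = (A ^+ 2 - 4 * n)%:~R.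
  by rewrite !(rmorphB, rmorphXn, rmorphM) /= -eA -en /c; ring.
(* Since d c^2 is an integer, the squared denominator of c divides d, which is squarefree. *)
have [B eB] : exists B : int, c = B%:~R.
  exists (numq c); rewrite -[LHS]divq_num_den.
  suff -> : denq c = 1 by rewrite divr1.
  have e : d%:Z * numq c ^+ 2 = (A ^+ 2 - 4 * n) * denq c ^+ 2.
    apply: (@intr_inj rat); rewrite !(rmorphXn, rmorphM) /= -ec.
    rewrite -{2}(divq_num_den c) expr_div_n; field.
    by rewrite intr_eq0 denq_neq0.
  have : (`|denq c| ^ 2 %| d)%N.
    rewrite -(@Gauss_dvdl _ _ (`|numq c| ^ 2)); last first.
      by rewrite coprimeXl // coprimeXr // coprime_sym coprime_num_den.
    have := congr1 absz e; rewrite !(abszX, abszM) /= => ->.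
    exact: dvdn_mull.
  move=> /(squarefree_sqr_dvd d_sqf)/(_ ltac:(lia)) dc1.
  by have := denq_gt0 c; lia.
exists A, B, n; split.
  rewrite halfz_rat -eA -eB /c; congr (ratr _ + ratr _ * _); by field.
apply: (@intr_inj rat); rewrite !(rmorphB, rmorphXn, rmorphM) /= -eA -eB -en /c.
by rewrite -pmulrn; ring.
Qed.

Lemma normK_int z : O z -> exists n : int, normK d z = n%:~R.
Proof. by move=> /quad_intP[a [b [n [-> /normK_halfz->]]]]; exists n. Qed.

End Quad.

(** * Ideal multiplication and the Picard group *)

Lemma card2_pigeonhole (T : Type) (A : set T) (a b c : T) :
  A #= `I_2 -> A a -> A b -> A c -> [\/ a = b, a = c | b = c].
Proof.
rewrite card_eq_le => /andP[/pcard_leP[f] _] Aa Ab Ac.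
have inj x y : A x -> A y -> f x = f y -> x = y.
  by move=> Ax Ay; apply: (@inj _ _ _ f); rewrite inE.
have lt2 x : A x -> (f x < 2)%N by move=> Ax; exact: (@funS _ _ _ _ f).
have [[fa fb] fc] := (lt2 a Aa, lt2 b Ab, lt2 c Ac).
have [/inj|nab] := eqVneq (f a) (f b); first by move=> /(_ Aa Ab); constructor 1.
have [/inj|nac] := eqVneq (f a) (f c); first by move=> /(_ Aa Ac); constructor 2.
by constructor 3; apply: inj => //; lia.
Qed.

Lemma card_set2 (T : Type) (a b : T) : a <> b -> [set x | x = a \/ x = b] #= `I_2.
Proof.
move=> ab; pose f n := if n is 0%N then a else b.
have -> : [set x | x = a \/ x = b] = [set f n | n in `I_2].
  apply/seteqP; split=> [x /= [->|->]|x /= [[|n] _ <-]]; [exists 0%N|exists 1%N|left|right] => //.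
by apply: inj_card_eq => -[|[|m]] [|[|n]]; rewrite !inE //= => _ _ // /esym.
Qed.

Definition scale (a : algC) (I : set algC) : set algC := [set a * z | z in I].

Lemma scale_mem a (I : set algC) z : I z -> scale a I (a * z).
Proof. by move=> Iz; exists z. Qed.

Lemma scale1 I : scale 1 I = I.
Proof. by apply/seteqP; split=> [z [w Iw <-]|z Iz]; [rewrite mul1r|exists z; rewrite ?mul1r]. Qed.

Lemma scaleA a b I : scale a (scale b I) = scale (a * b) I.
Proof.
apply/seteqP; split=> [z [_ [w Iw <-] <-]|z [w Iw <-]].
  by exists w; rewrite ?mulrA.
by exists (b * w); [exists w|rewrite mulrA].
Qed.

Definition add_closed (T : set algC) : Prop := T 0 /\ forall u v, T u -> T v -> T (u + v).

(** Induction principle for products. T is only required to be closed under addition, so that it may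
    be a condition such as membership of a fixed multiple of w. *)
Lemma ideal_mul_sub (I J T : set algC) :
  add_closed T -> (forall u v, I u -> J v -> T (u * v)) -> ideal_mul I J `<=` T.
Proof.
move=> [T0 TD] IJT z [n [u [v [uv ->]]]].
by elim/big_ind: _ => // i _; have [] := uv i; apply: IJT.
Qed.

Lemma ideal_mul_mem (I J : set algC) u v : I u -> J v -> ideal_mul I J (u * v).
Proof.
by move=> Iu Jv; exists 1%N, (fun=> u), (fun=> v); split=> //; rewrite big_ord1.
Qed.

Lemma ideal_mul_add (I J : set algC) : add_closed (ideal_mul I J).
Proof.
split=> [|_ _ [n [u [v [uv ->]]]] [m [u' [v' [uv' ->]]]]].
  exists 0%N, (fun=> 0), (fun=> 0); split=> [[]//|]; by rewrite big_ord0.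
exists (n + m)%N, (fun i => match fintype.split i with inl i => u i | inr j => u' j end),
  (fun i => match fintype.split i with inl i => v i | inr j => v' j end); split.
  by move=> i; case: (fintype.split i) => j.
rewrite big_split_ord /=; congr (_ + _); apply: eq_bigr => i _.
  by rewrite (unsplitK (inl _ i)).
by rewrite (unsplitK (inr _ i)).
Qed.

Lemma ideal_mulC I J : ideal_mul I J = ideal_mul J I.
Proof.
by apply/seteqP; split; apply: ideal_mul_sub (ideal_mul_add _ _) _ => u v Iu Jv;
  rewrite mulrC; apply: ideal_mul_mem.
Qed.

Lemma ideal_mulA I J L : ideal_mul I (ideal_mul J L) = ideal_mul (ideal_mul I J) L.
Proof.
have sub (A B C : set algC) :
    ideal_mul (ideal_mul A B) C `<=` ideal_mul A (ideal_mul B C).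
  have [m0 mD] := ideal_mul_add A (ideal_mul B C).
  apply: ideal_mul_sub => // w c ABw Cc.
  suff : ideal_mul A B `<=` [set w | ideal_mul A (ideal_mul B C) (w * c)] by apply.
  apply: ideal_mul_sub => [|u v Au Bv /=].
    by split=> [|u v] /=; rewrite ?mul0r // mulrDl; apply: mD.
  by rewrite -mulrA; do 2 apply: ideal_mul_mem => //.
apply/seteqP; split; last exact: sub.
rewrite ideal_mulC (ideal_mulC J) (ideal_mulC _ L) (ideal_mulC I); exact: sub.
Qed.

Lemma ideal_mul_scale a I J : ideal_mul (scale a I) J = scale a (ideal_mul I J).
Proof.
have [IJ0 IJD] := ideal_mul_add I J.
apply/seteqP; split.
  apply: ideal_mul_sub => [|_ v [u Iu <-] Jv].
    split=> [|_ _ [u IJu <-] [v IJv <-]]; first by exists 0; rewrite ?mulr0.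
    by exists (u + v); [apply: IJD|rewrite mulrDr].
  by rewrite -mulrA; apply: scale_mem; apply: ideal_mul_mem.
move=> _ [w IJw <-].
suff : ideal_mul I J `<=` [set w | ideal_mul (scale a I) J (a * w)] by apply.
have [S0 SD] := ideal_mul_add (scale a I) J.
apply: ideal_mul_sub => [|u v Iu Jv /=].
  by split=> [|u v] /=; rewrite ?mulr0 // mulrDr; apply: SD.
by rewrite mulrA; apply: ideal_mul_mem => //; apply: scale_mem.
Qed.

Lemma ideal_mul_scaler a I J : ideal_mul I (scale a J) = scale a (ideal_mul I J).
Proof. by rewrite ideal_mulC ideal_mul_scale ideal_mulC. Qed.

(** * Orders of K, fractional ideals, and class groups with two elements *)

Section Orders.

Variable d : nat.
Hypothesis d_ge2 : (2 <= d)%N.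
Hypothesis d_sqf : squarefree d.

Record is_order (O : set algC) : Prop := IsOrder {
  order_field : O `<=` quad_field d;
  order1 : O 1;
  orderD : forall u v, O u -> O v -> O (u + v);
  orderN : forall u, O u -> O (- u);
  orderM : forall u v, O u -> O v -> O (u * v) }.

Lemma order0 O : is_order O -> O 0.
Proof. by move=> oO; rewrite -(subrr 1); apply: orderD => //; [|apply: orderN => //]; apply: order1. Qed.

Lemma order_nat O n : is_order O -> O n%:R.
Proof.
move=> oO; elim: n => [|n IH]; first exact: order0.
by rewrite -addn1 natrD; apply: orderD => //; apply: order1.
Qed.

Lemma order_int O (m : int) : is_order O -> O m%:~R.
Proof.
move=> oO; case: m => n; first exact: order_nat.
by rewrite NegzE mulrNz; apply: orderN => //; apply: order_nat.
Qed.

Lemma quad_int_order : is_order (quad_int d).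
Proof.
split; [by move=> z []|exact: (quad_int_nat d 1)|exact: quad_intD|exact: quad_intN|exact: quad_intM].
Qed.

Lemma quad_order_sub f : quad_order d f `<=` quad_int d.
Proof.
by move=> _ [m [w [Ow ->]]]; apply: quad_intD;
  [apply: quad_int_int|apply: quad_intM => //; apply: quad_int_nat].
Qed.

Lemma quad_order_order f : is_order (quad_order d f).
Proof.
split=> [z /quad_order_sub[]//||||].
- exists 1, 0; split; [exact: (quad_int_nat d 0)|by rewrite mulr0 addr0].
- move=> _ _ [m [w [Ow ->]]] [n [v [Ov ->]]]; exists (m + n), (w + v).
  by split; [apply: quad_intD|rewrite rmorphD /=; ring].
- move=> _ [m [w [Ow ->]]]; exists (- m), (- w).
  by split; [apply: quad_intN|rewrite rmorphN /=; ring].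
- move=> _ _ [m [w [Ow ->]]] [n [v [Ov ->]]].
  exists (m * n), (m%:~R * v + n%:~R * w + f%:R * (w * v)); split.
    by apply: quad_intD; first apply: quad_intD; apply: quad_intM => //;
      [exact: quad_int_int|exact: quad_int_int|exact: quad_int_nat|exact: quad_intM].
  by rewrite rmorphM /=; ring.
Qed.

Section OneOrder.

Variable O : set algC.
Hypothesis oO : is_order O.

Lemma frac0 I : fractional_ideal d O I -> I 0.
Proof. by move=> [_ [z Iz _] _ IM _]; rewrite -(mul0r z); apply: IM => //; apply: order0. Qed.

Lemma frac_add I : fractional_ideal d O I -> add_closed I.
Proof. by move=> fI; split; [apply: frac0|case: fI]. Qed.

Lemma ideal_mul1 I : fractional_ideal d O I -> ideal_mul O I = I.
Proof.
move=> fI; apply/seteqP; split; last first.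
  by move=> z Iz; rewrite -(mul1r z); apply: ideal_mul_mem => //; apply: order1.
by apply: ideal_mul_sub; [apply: frac_add|case: fI].
Qed.

Lemma order_frac : fractional_ideal d O O.
Proof.
have O1 := order1 oO.
split; [exact: (order_field oO)|by exists 1; rewrite ?oner_neq0|exact: (orderD oO)|exact: (orderM oO)|].
by exists 1; split=> [||u]; rewrite ?mul1r ?oner_neq0.
Qed.

Lemma order_idem : ideal_mul O O = O.
Proof. exact/ideal_mul1/order_frac. Qed.

Lemma order_invertible : invertible_ideal d O O.
Proof. by split; [|exists O]; rewrite ?ideal_mul1 //; apply: order_frac. Qed.

Lemma scale_frac a I : quad_field d a -> a != 0 ->
  (exists c, [/\ O c, c != 0 & O (c * a)]) ->
  fractional_ideal d O I -> fractional_ideal d O (scale a I).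
Proof.
move=> aK a0 [c [Oc c0 Oca]] [IK [z Iz z0] ID IM [e [Oe e0 eI]]]; split.
- by move=> _ [u Iu <-]; apply: quad_fieldM => //; apply: IK.
- by exists (a * z); [apply: scale_mem|rewrite mulf_neq0].
- by move=> _ _ [u Iu <-] [v Iv <-]; rewrite -mulrDr; apply: scale_mem; apply: ID.
- by move=> b _ Ob [u Iu <-]; rewrite mulrCA; apply: scale_mem; apply: IM.
- exists (c * e); split; [exact: orderM|by rewrite mulf_neq0|].
  move=> _ [u Iu <-]; have -> : c * e * (a * u) = c * a * (e * u) by ring.
  by apply: orderM => //; apply: eI.
Qed.

Lemma mul_frac I J : fractional_ideal d O I -> fractional_ideal d O J ->
  fractional_ideal d O (ideal_mul I J).
Proof.
move=> [IK [z Iz z0] ID IM [c [Oc c0 cI]]] [JK [w Jw w0] JD JM [e [Oe e0 eJ]]].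
have [m0 mD] := ideal_mul_add I J.
split.
- apply: ideal_mul_sub => [|u v Iu Jv]; last by apply: quad_fieldM; [apply: IK|apply: JK].
  by split; [exact: (quad_field_nat d 0)|exact: quad_fieldD].
- by exists (z * w); [apply: ideal_mul_mem|rewrite mulf_neq0].
- exact: mD.
- move=> a u Oa; suff : ideal_mul I J `<=` [set u | ideal_mul I J (a * u)] by apply.
  apply: ideal_mul_sub => [|x y Ix Jy /=].
    by split=> [|x y] /=; rewrite ?mulr0 // mulrDr; apply: mD.
  by rewrite mulrA; apply: ideal_mul_mem => //; apply: IM.
- exists (c * e); split; [exact: orderM|by rewrite mulf_neq0|].
  suff : ideal_mul I J `<=` [set u | O (c * e * u)] by move=> S u /S.
  apply: ideal_mul_sub => [|x y Ix Jy /=].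
    by split=> [|x y] /=; [rewrite mulr0; apply: order0|rewrite mulrDr; apply: orderD].
  have -> : c * e * (x * y) = c * x * (e * y) by ring.
  by apply: orderM; [|apply: cI|apply: eJ].
Qed.

Lemma mul_invertible I J : invertible_ideal d O I -> invertible_ideal d O J ->
  invertible_ideal d O (ideal_mul I J).
Proof.
move=> [fI [I' fI' II']] [fJ [J' fJ' JJ']]; split; first exact: mul_frac.
exists (ideal_mul I' J'); first exact: mul_frac.
rewrite ideal_mulA -(ideal_mulA I) (ideal_mulC J) ideal_mulA II' -ideal_mulA JJ'.
exact/ideal_mul1/order_frac.
Qed.

Lemma ideal_class_eq I J : fractional_ideal d O I ->
  (ideal_class d I = ideal_class d J) <->
  exists a, [/\ quad_field d a, a != 0 & J = scale a I].
Proof.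
move=> fI; split=> [e|[a [aK a0 ->]]].
  have : ideal_class d J J.
    by exists 1; rewrite oner_neq0 -/(scale 1 J) scale1; split=> //; apply: (quad_field_nat d 1).
  by rewrite -e.
apply/seteqP; split=> L [b [bK b0 ->]].
  exists (b / a); split; [by apply: quad_fieldM => //; apply: quad_fieldV|by rewrite mulf_neq0 ?invr_eq0|].
  by apply: etrans (esym (scaleA _ _ _)); rewrite divfK.
by exists (b * a); split; [apply: quad_fieldM|rewrite mulf_neq0|apply: scaleA].
Qed.

Hypothesis Pic2 : Pic d O #= `I_2.

(** The form in which the assumption of class number 2 is exploited: no group law on classes is
    involved. *)
Lemma Pic2_pigeonhole I1 I2 I3 : invertible_ideal d O I1 -> invertible_ideal d O I2 ->
  invertible_ideal d O I3 ->
  exists a, [/\ quad_field d a, a != 0 & [\/ I2 = scale a I1, I3 = scale a I1 | I3 = scale a I2]].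
Proof.
move=> i1 i2 i3.
have P I : invertible_ideal d O I -> Pic d O (ideal_class d I) by move=> iI; exists I.
have [/ideal_class_eq|/ideal_class_eq|/ideal_class_eq] :=
  card2_pigeonhole Pic2 (P _ i1) (P _ i2) (P _ i3).
- by case: i1 => fI _ /(_ fI)[a [aK a0 e]]; exists a; split=> //; constructor.
- by case: i1 => fI _ /(_ fI)[a [aK a0 e]]; exists a; split=> //; constructor.
- by case: i2 => fI _ /(_ fI)[a [aK a0 e]]; exists a; split=> //; constructor.
Qed.

(** Two of O, I, I^2 are homothetic, and each coincidence makes I^2 principal; if I^2 = aI,
    multiplying by an inverse of I leaves I = aO. *)
Lemma Pic2_square I : invertible_ideal d O I ->
  exists a, [/\ quad_field d a, a != 0 & ideal_mul I I = scale a O].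
Proof.
move=> iI; have iII := mul_invertible iI iI.
have [a [aK a0 [->|->|e]]] := Pic2_pigeonhole order_invertible iI iII.
- exists (a * a); rewrite mulf_neq0 // ideal_mul_scale ideal_mul_scaler scaleA.
  rewrite order_idem; split=> //; exact: quad_fieldM.
- by exists a.
case: iI => fI [I' fI' II'].
have IaO : I = scale a O.
  have := congr1 (ideal_mul I') e; rewrite ideal_mul_scaler ideal_mulA (ideal_mulC I') II'.
  by rewrite ideal_mul1.
exists (a * a); rewrite mulf_neq0 // {1 2}IaO ideal_mul_scale ideal_mul_scaler scaleA.
rewrite order_idem; split=> //; exact: quad_fieldM.
Qed.

End OneOrder.

Lemma Pic2_intro O P : is_order O -> invertible_ideal d O P ->
  (forall a, quad_field d a -> a != 0 -> P <> scale a O) ->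
  (forall I, invertible_ideal d O I -> exists a,
     [/\ quad_field d a, a != 0 & I = scale a O \/ I = scale a P]) ->
  Pic d O #= `I_2.
Proof.
move=> oO iP nP alln; have fP : fractional_ideal d O P by case: iP.
have fO := order_frac oO.
have ne : ideal_class d O <> ideal_class d P.
  by move=> /(ideal_class_eq _ fO)[a [aK a0 /(nP a)]]; apply.
rewrite (_ : Pic d O = [set x | x = ideal_class d O \/ x = ideal_class d P]).
  exact: card_set2.
apply/seteqP; split=> [_ [I iI <-]|_ [->|->]]; last 2 first.
- by exists O => //; apply: order_invertible.
- by exists P.
have [a [aK a0 [e|e]]] := alln I iI.
  by left; apply/esym; apply/(ideal_class_eq _ fO); exists a.
by right; apply/esym; apply/(ideal_class_eq _ fP); exists a.
Qed.

End Orders.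

(** * Units and squares up to units *)

Lemma int_parity (k : int) : exists j : int, k = 2 * j \/ k = 2 * j + 1.
Proof. by exists (k %/ 2)%Z; lia. Qed.

Lemma prime_coprime2 r : prime r -> r != 2%N -> coprime r 2.
Proof. by move=> pr r2; rewrite prime_coprime // dvdn_prime2. Qed.

Lemma dvdz_odd_double r (a : int) : prime r -> r != 2%N -> (r%:Z %| 2 * a)%Z -> (r%:Z %| a)%Z.
Proof. by move=> pr r2; rewrite Gauss_dvdzr // coprimezE prime_coprime2. Qed.

Lemma nonsquare_prime l m s : prime l -> (l %| m)%N -> ~~ (l ^ 2 %| m)%N -> m <> (s ^ 2)%N.
Proof.
move=> pl lm lm2 ms; case/negP: lm2; move: lm.
by rewrite ms Euclid_dvdX // => /andP[ls _]; rewrite dvdn_exp2r.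
Qed.

Lemma prime_sqr_ndvd p : prime p -> ~~ (p ^ 2 %| p)%N.
Proof. by move=> pp; rewrite gtnNdvd ?prime_gt0 // ltn_Pmull ?prime_gt1 ?prime_gt0. Qed.

Lemma two_neq0 : 2 != 0 :> algC. Proof. by rewrite pnatr_eq0. Qed.

Section Units.

Variable d : nat.
Hypothesis d_ge2 : (2 <= d)%N.
Hypothesis d_sqf : squarefree d.

Local Notation sd := (sqrtC (d%:R : algC)).
Local Notation O := (quad_int d).

(** If g^2 is rational, then g is rational or a rational multiple of sqrt d, so m or d m is a square
    of an integer. The first is excluded by l1, which divides m exactly once, the second by l2,
    which divides d m exactly once. *)
Lemma natr_nonsquare m l1 l2 g : prime l1 -> prime l2 -> (l1 %| m)%N -> ~~ (l1 ^ 2 %| m)%N ->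
  (l2 %| d)%N -> ~~ (l2 %| m)%N -> quad_field d g -> g ^+ 2 <> m%:R.
Proof.
move=> p1 p2 l1m l1m2 l2d l2m [a [b ->]] e.
have [e1 e2] : a ^+ 2 + d%:R * b ^+ 2 = m%:R /\ 2 * a * b = 0.
  apply: (sd_inj d_ge2 d_sqf); rewrite rmorph0 mul0r addr0 rmorph_nat -e.
  rewrite !(rmorphD, rmorphXn, rmorphM, rmorph_nat) /=.
  by move: (sdE d); move: sd => s <-; ring.
move/eqP: e2; rewrite !mulf_eq0 /= => /orP[/eqP a0|/eqP b0].
  have /rat_sqr_nat[s ds] : (d%:R * b) ^+ 2 = (d * m)%:R.
    by rewrite natrM -e1 a0; ring.
  have l2s : (l2 ^ 2 %| d * m)%N.
    have : (l2 %| s ^ 2)%N by rewrite -ds dvdn_mulr.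
    by rewrite Euclid_dvdX // ds => /andP[l2s _]; rewrite dvdn_exp2r.
  have /negP[] := d_sqf p2.
  by move: l2s; rewrite Gauss_dvdl // coprimeXl // prime_coprime.
have /rat_sqr_nat[s ms] : a ^+ 2 = m%:R by rewrite -e1 b0; ring.
exact: (nonsquare_prime p1 l1m l1m2 ms).
Qed.

Lemma halfzM a b a' b' :
  2 * (halfz d a b * halfz d a' b') = halfz d (a * a' + d%:Z * b * b') (a * b' + b * a').
Proof.
rewrite /halfz !(rmorphD, rmorphM) /=.
have -> : (d%:Z%:~R : algC) = d%:R by [].
by move: (sdE d); move: sd => s <-; field.
Qed.

Lemma halfz_unit a b s : a ^+ 2 - d%:Z * b ^+ 2 = 4 * s -> s ^+ 2 = 1 -> quad_unit d (halfz d a b).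
Proof.
move=> e s1; split; first exact: halfz_int e.
exists (halfz d (s * a) (- (s * b))).
  by apply: (@halfz_int d _ _ s); rewrite sqrrN !exprMn s1 !mul1r.
apply: (mulfI two_neq0); rewrite halfzM.
have -> : a * (s * a) + d%:Z * b * - (s * b) = 4 * (s ^+ 2).
  by transitivity (s * (4 * s)); [rewrite -e|]; ring.
have -> : a * - (s * b) + b * (s * a) = 0 by ring.
by rewrite s1 /halfz; field.
Qed.

Lemma quad_unit_norm u : quad_unit d u -> normK d u = 1 \/ normK d u = -1.
Proof.
move=> [Ou [v Ov uv]].
have [[m em] [n en]] := (normK_int d_ge2 d_sqf Ou, normK_int d_ge2 d_sqf Ov).
have mn : m * n = 1.
  apply: (@intr_inj rat); rewrite rmorphM /= -em -en -normKM //; [|by case: Ou|by case: Ov].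
  have := normKE d_ge2 d_sqf 1 0; rewrite uv rmorph1 rmorph0 mul0r addr0 => ->; ring.
have : `|m|%N = 1%N.
  by have := congr1 absz mn; rewrite abszM => /eqP; rewrite muln_eq1 => /andP[/eqP].
rewrite em => m1; have [->|->] : m = 1 \/ m = -1 by lia.
  by left.
by right.
Qed.

Variable eps : algC.
Hypothesis eps_fund : fundamental_unit d eps.

Lemma eps_gt0 : 0 < eps. Proof. by case: eps_fund => e1 _; apply: lt_trans e1. Qed.
Lemma eps_neq0 : eps != 0. Proof. by rewrite gt_eqF ?eps_gt0. Qed.

Lemma eps_pow_unit (k : int) : quad_unit d (eps ^ k).
Proof. by case: eps_fund => _ H; apply/H; exists k; left. Qed.

Lemma eps_pow_field (k : int) : quad_field d (eps ^ k).
Proof. by have [[]] := eps_pow_unit k. Qed.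

Lemma pos_unit u : quad_unit d u -> 0 < u -> exists k, u = eps ^ k.
Proof.
case: eps_fund => _ H /H[k [->|->]] u0; exists k => //.
by have := exprz_gt0 k eps_gt0; rewrite -oppr_lt0 => /(lt_trans u0); rewrite ltxx.
Qed.

Lemma expz_even k : eps ^ (2 * k) = (eps ^ k) ^+ 2.
Proof. by rewrite mulrC -exprz_exp. Qed.

(** Rules out a generator g of an ideal with square (r). Powers of eps represent all relevant units,
    because g is real and so g^2 is positive. *)
Definition no_unit_multiple_square (r : nat) : Prop :=
  forall g k, quad_field d g -> g ^+ 2 <> r%:R * eps ^ k.

Lemma even_power_nonsquare m l1 l2 g k : prime l1 -> prime l2 -> (l1 %| m)%N ->
  ~~ (l1 ^ 2 %| m)%N -> (l2 %| d)%N -> ~~ (l2 %| m)%N -> quad_field d g ->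
  g ^+ 2 <> m%:R * eps ^ (2 * k).
Proof.
move=> p1 p2 l1m l1m2 l2d l2m gK e.
apply: (@natr_nonsquare m l1 l2 (g / eps ^ k)) => //.
  by apply: quad_fieldM => //; apply: quad_fieldV => //; apply: eps_pow_field.
by rewrite expr_div_n e expz_even mulfK // sqrf_eq0 expfz_neq0 ?eps_neq0.
Qed.

(** Even powers of eps are absorbed into g. For an odd power, taking norms gives N(g)^2 = -(r
    N(eps^j))^2, which is negative. *)
Lemma no_square_of_norm r r' : prime r -> prime r' -> r != r' -> (r' %| d)%N ->
  normK d eps = -1 -> no_unit_multiple_square r.
Proof.
move=> pr pr' rr' r'd Ne g k gK; have [j [->|->]] := int_parity k.
  apply: (@even_power_nonsquare r r r') => //; last by rewrite dvdn_prime2 // eq_sym.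
  exact: prime_sqr_ndvd.
have eK : quad_field d eps by have := eps_pow_field 1; rewrite expr1z.
move=> e; have := congr1 (normK d) e.
have -> : r%:R * eps ^ (2 * j + 1) = r%:R * (eps ^ j * eps ^ j * eps).
  by rewrite expfzDr ?eps_neq0 // expr1z expz_even expr2.
have rK : quad_field d r%:R by apply: quad_field_nat.
have jK := eps_pow_field j.
rewrite expr2 !normKM // ?Ne; try by do ![apply: quad_fieldM].
set n := normK d g; set m := normK d (eps ^ j).
have -> : normK d r%:R = r%:R ^+ 2.
  have := normKE d_ge2 d_sqf r%:R 0; rewrite rmorph_nat rmorph0 mul0r addr0 => ->; ring.
have m0 : m != 0.
  have [] := quad_unit_norm (eps_pow_unit j); rewrite -/m => ->; by [].
move=> e2; have : 0 < n * n + (r%:R * m) ^+ 2.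
  by rewrite ltr_wpDl ?sqr_ge0 // exprn_even_gt0 // mulf_neq0 // pnatr_eq0 -lt0n prime_gt0.
by rewrite e2; have -> : r%:R ^+ 2 * (m * m * -1) + (r%:R * m) ^+ 2 = 0 by ring; rewrite ltxx.
Qed.

(** The exponent l is odd because 2 is not a square in K. If g^2 = r eps^k, then k is odd likewise,
    and (c g)^2 is 2r times an even power of eps, although 2r is not a square in K. *)
Lemma no_square_of_two r r' c l : prime r -> prime r' -> r != r' -> r != 2%N -> r' != 2%N ->
  (r' %| d)%N -> quad_field d c -> c ^+ 2 = 2 * eps ^ l -> no_unit_multiple_square r.
Proof.
move=> pr pr' rr' r2 r'2 r'd cK.
have [i [->|->]] := int_parity l.
  by move/(@even_power_nonsquare 2 2 r')=> []//; rewrite dvdn_prime2.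
move=> ce g k gK; have [j [->|->]] := int_parity k.
  by apply: (@even_power_nonsquare r r r') => //; [exact: prime_sqr_ndvd|rewrite dvdn_prime2 // eq_sym].
move=> ge; apply: (@even_power_nonsquare (2 * r) r r' (c * g) (i + j + 1)) => //.
- exact: dvdn_mull.
- by rewrite expnS expn1 dvdn_pmul2r ?prime_gt0 // dvdn_prime2.
- by rewrite Euclid_dvdM // !dvdn_prime2 // negb_or r'2 eq_sym.
- exact: quad_fieldM.
rewrite exprMn ce ge natrM mulrACA -expfzDr ?eps_neq0 //; congr (_ * eps ^ _); ring.
Qed.

Lemma no_unit_multiple_unit r u g : no_unit_multiple_square r -> (0 < r)%N ->
  quad_unit d u -> quad_field d g -> g \is Num.real -> g ^+ 2 <> r%:R * u.
Proof.
move=> nr r0 uu gK gR e.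
have u0 : 0 < u.
  have : 0 <= r%:R * u by rewrite -e -realEsqr.
  rewrite pmulr_rge0 ?ltr0n // le_eqVlt => /orP[/eqP u0|//].
  by case: uu => _ [v _ /eqP]; rewrite -u0 mul0r eq_sym oner_eq0.
by have [k uk] := pos_unit uu u0; apply: (nr g k) => //; rewrite -uk.
Qed.

Lemma quad_field_real z : quad_field d z -> z \is Num.real.
Proof.
have qR (q : rat) : (ratr q : algC) \is Num.real by apply/Creal_Crat/Crat_rat.
move=> [a [b ->]]; apply: realD => //; apply: realM => //.
by rewrite sqrtC_real ?ler0n.
Qed.

Lemma disc_dvd r : (r %| d)%N -> (r %| disc d)%N.
Proof. by move=> rd; rewrite /disc; case: ifP => // _; apply: dvdn_mull. Qed.

(** Write d_K = c^2 d with c = 1 or 2. A solution (a, b) makes g = (r a + c b sqrt d)/2 an element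
    of norm r or -r, and then g^2 / r = u is a unit, which contradicts [nr]. The coordinates of u
    below are those of g^2 / r, with r a^2 eliminated. *)
Lemma norm_condition r : prime r -> (r %| d)%N -> no_unit_multiple_square r ->
  forall a b : int, `|r%:Z * a ^+ 2 - (disc d %/ r)%N%:Z * b ^+ 2| != 4.
Proof.
move=> pr rd nr a b; apply/eqP => ab4.
set e := (disc d %/ r)%N%:Z in ab4.
have [c ce] : exists c : int, r%:Z * e = c ^+ 2 * d%:Z.
  have -> : r%:Z * e = (disc d)%:Z by rewrite /e -PoszM mulnC divnK // disc_dvd.
  by rewrite /disc; case: ifP => _; [exists 1|exists 2]; lia.
have [s [s1 es]] : exists s : int, s ^+ 2 = 1 /\ r%:Z * a ^+ 2 - e * b ^+ 2 = 4 * s.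
  have [H|H] : r%:Z * a ^+ 2 - e * b ^+ 2 = 4 \/ r%:Z * a ^+ 2 - e * b ^+ 2 = -4 by lia.
    by exists 1.
  by exists (-1).
have uu : quad_unit d (halfz d (2 * s + e * b ^+ 2) (a * b * c)).
  apply: (@halfz_unit _ _ 1); rewrite ?expr1n //.
  have -> : d%:Z * (a * b * c) ^+ 2 = (r%:Z * a ^+ 2 - e * b ^+ 2 + e * b ^+ 2) * e * b ^+ 2.
    transitivity (c ^+ 2 * d%:Z * a ^+ 2 * b ^+ 2); first by ring.
    by rewrite -ce; ring.
  by rewrite es; transitivity (4 * (s ^+ 2)); [ring|rewrite s1].
have gK : quad_field d (halfz d (r%:Z * a) (c * b)).
  by rewrite halfz_rat; do 2 eexists; reflexivity.
apply: (no_unit_multiple_unit nr (prime_gt0 pr) uu gK (quad_field_real gK)).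
apply: (mulfI two_neq0); rewrite expr2 halfzM.
have -> : r%:Z * a * (r%:Z * a) + d%:Z * (c * b) * (c * b) = r%:Z * (4 * s + 2 * e * b ^+ 2).
  transitivity (r%:Z * (r%:Z * a ^+ 2) + c ^+ 2 * d%:Z * b ^+ 2); first by ring.
  have -> : r%:Z * a ^+ 2 = 4 * s + e * b ^+ 2 by rewrite -es; ring.
  by rewrite -ce; ring.
rewrite /halfz !(rmorphD, rmorphM, rmorphXn) /=.
have -> : (r%:Z%:~R : algC) = r%:R by [].
by field.
Qed.

End Units.

(** * The kernel of Pic(O_f) -> Pic(O_K) *)

Section Ideals.

Variable d : nat.
Hypothesis d_ge2 : (2 <= d)%N.
Hypothesis d_sqf : squarefree d.

Local Notation sd := (sqrtC (d%:R : algC)).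
Local Notation O := (quad_int d).

Lemma quad_orderP r z : odd r -> quad_order d r z <->
  exists a b n, [/\ z = halfz d a b, a ^+ 2 - d%:Z * b ^+ 2 = 4 * n & (r%:Z %| b)%Z].
Proof.
move=> ro; split=> [[m [w [/(quad_intP d_ge2 d_sqf)[a [b [n [-> e]]]] ->]]]|
  [a [b0 [n [-> e /dvdzP[b be]]]]]].
  exists (2 * m + r%:Z * a), (r%:Z * b), (m ^+ 2 + m * r%:Z * a + r%:Z ^+ 2 * n).
  split; last exact: dvdz_mulr.
    rewrite /halfz !(rmorphD, rmorphM) /=.
    have -> : (r%:Z%:~R : algC) = r%:R by [].
    by field.
  transitivity (4 * m ^+ 2 + 4 * m * r%:Z * a + r%:Z ^+ 2 * (a ^+ 2 - d%:Z * b ^+ 2)); first ring.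
  by rewrite e; ring.
move: e; rewrite {}be => e.
have [h rh] : exists h : int, r%:Z = 2 * h + 1 by exists (r./2)%:Z; lia.
(* As r = 2h + 1, the integer h + 1 is a half modulo r: a/2 = a(h + 1) - r a/2. *)
exists (a * (h + 1)), (halfz d (- a) b); split.
  apply/(quad_intP d_ge2 d_sqf); exists (- a), b, ((h ^+ 2 + h) * (d%:Z * b ^+ 2) + n); split=> //.
  rewrite rh in e; rewrite mulrDr -e; ring.
have -> : (r%:R : algC) = r%:Z%:~R by [].
by rewrite /halfz rh !(rmorphD, rmorphM, rmorphN) /=; field.
Qed.

(** The coefficient rings may differ: with O1 = O_f, O2 = O_K and h = f this is g O_f + f O_K, while
    O1 = O2 gives the ordinary ideal (g, h). *)
Definition gen2 (O1 : set algC) (g : algC) (O2 : set algC) (h : algC) : set algC :=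
  [set z | exists a b, [/\ O1 a, O2 b & z = g * a + h * b]].

Section Gen2.

Variables O1 O2 : set algC.
Hypothesis oO1 : is_order d O1.
Hypothesis oO2 : is_order d O2.
Hypothesis sO : O1 `<=` O2.

Lemma gen2_frac g h c : quad_field d g -> quad_field d h -> h != 0 ->
  O1 c -> c != 0 -> O1 (c * g) -> (forall b, O2 b -> O1 (c * h * b)) ->
  fractional_ideal d O1 (gen2 O1 g O2 h).
Proof.
move=> gK hK h0 Oc c0 Ocg Och; split.
- move=> _ [a [b [/(order_field oO1) aK /(order_field oO2) bK ->]]].
  by apply: quad_fieldD; apply: quad_fieldM.
- exists h => //; exists 0, 1; rewrite mulr0 add0r mulr1; split=> //.
    exact: (order0 oO1).
  exact: (order1 oO2).
- move=> _ _ [a [b [Oa Ob ->]]] [a' [b' [Oa' Ob' ->]]]; exists (a + a'), (b + b').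
  by split; [apply: (orderD oO1)|apply: (orderD oO2)|ring].
- move=> u _ Ou [a [b [Oa Ob ->]]]; exists (u * a), (u * b).
  by split; [apply: (orderM oO1)|apply: (orderM oO2) => //; apply: sO|ring].
- exists c; split=> // _ [a [b [Oa Ob ->]]].
  have -> : c * (g * a + h * b) = c * g * a + c * h * b by ring.
  by apply: (orderD oO1); [apply: (orderM oO1)|apply: Och].
Qed.

Lemma gen2_mem1 g h : gen2 O1 g O2 h g.
Proof. by exists 1, 0; split; [apply: (order1 oO1)|apply: (order0 oO2)|ring]. Qed.

Lemma gen2_mem2 g h b : O2 b -> gen2 O1 g O2 h (h * b).
Proof. by exists 0, b; split=> //; [apply: (order0 oO1)|ring]. Qed.

Lemma gen2_mul g h g' h' c :
  fractional_ideal d O1 (scale c O1) ->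
  fractional_ideal d O1 (gen2 O1 g O2 h) -> fractional_ideal d O1 (gen2 O1 g' O2 h') ->
  scale c O1 (g * g') -> (forall b, O2 b -> scale c O1 (g * h' * b)) ->
  (forall b, O2 b -> scale c O1 (h * g' * b)) -> (forall b, O2 b -> scale c O1 (h * h' * b)) ->
  ideal_mul (gen2 O1 g O2 h) (gen2 O1 g' O2 h') c ->
  ideal_mul (gen2 O1 g O2 h) (gen2 O1 g' O2 h') = scale c O1.
Proof.
move=> fc f1 f2 c1 c2 c3 c4 cin; have [m0 mD] := frac_add oO1 fc.
have cM : forall a u, O1 a -> scale c O1 u -> scale c O1 (a * u) by case: fc.
apply/seteqP; split.
  apply: ideal_mul_sub => // _ _ [a [b [Oa Ob ->]]] [a' [b' [Oa' Ob' ->]]].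
  have -> : (g * a + h * b) * (g' * a' + h' * b') =
    a * a' * (g * g') + g * h' * (a * b') + h * g' * (a' * b) + h * h' * (b * b') by ring.
  apply: (mD); last by apply: c4; apply: (orderM oO2).
  apply: (mD); last by apply: c3; apply: (orderM oO2) => //; apply: sO.
  apply: (mD); last by apply: c2; apply: (orderM oO2) => //; apply: sO.
  by apply: cM => //; apply: (orderM oO1).
move=> _ [a Oa <-]; rewrite mulrC.
by have [_ _ _ + _] := mul_frac oO1 f1 f2; apply.
Qed.

End Gen2.

Lemma scale_nat_frac O1 c : is_order d O1 -> (0 < c)%N -> fractional_ideal d O1 (scale c%:R O1).
Proof.
move=> oO1 c0; apply: scale_frac (order_frac oO1) => //.
- exact: quad_field_nat.
- by rewrite pnatr_eq0 -lt0n.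
- by exists 1; rewrite mul1r oner_neq0; split=> //; [apply: order1 oO1|apply: order_nat oO1].
Qed.

Lemma invertible_of_mul O1 I J c : is_order d O1 -> (0 < c)%N ->
  fractional_ideal d O1 I -> fractional_ideal d O1 J ->
  ideal_mul I J = scale c%:R O1 -> invertible_ideal d O1 I.
Proof.
move=> oO1 c0 fI fJ IJ; have cn0 : c%:R != 0 :> algC by rewrite pnatr_eq0 -lt0n.
split=> //; exists (scale c%:R^-1 J).
  apply: scale_frac => //; [by apply: quad_fieldV => //; apply: quad_field_nat|by rewrite invr_eq0|].
  by exists c%:R; rewrite divff //; split=> //; [apply: order_nat oO1|apply: order1 oO1].
by rewrite ideal_mul_scaler IJ scaleA mulVf // scale1.
Qed.

Variable eps : algC.
Hypothesis eps_fund : fundamental_unit d eps.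
Variables X Y s0 : int.
Hypothesis eps_half : eps = halfz d X Y.
Hypothesis eps_norm : X ^+ 2 - d%:Z * Y ^+ 2 = 4 * s0.
Hypothesis s0_sqr : s0 ^+ 2 = 1.

Lemma epsV : eps^-1 = halfz d (s0 * X) (- (s0 * Y)).
Proof.
apply: (mulfI (eps_neq0 eps_fund)); rewrite divff ?(eps_neq0 eps_fund) //.
apply: (mulfI two_neq0); rewrite eps_half halfzM.
have -> : X * (s0 * X) + d%:Z * Y * - (s0 * Y) = 4 * (s0 ^+ 2).
  by transitivity (s0 * (4 * s0)); [rewrite -eps_norm|]; ring.
have -> : X * - (s0 * Y) + Y * (s0 * X) = 0 by ring.
by rewrite s0_sqr /halfz; field.
Qed.

Lemma unit_in_order r u : odd r -> (r%:Z %| Y)%Z -> quad_unit d u -> quad_order d r u.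
Proof.
move=> ro rY; have [_ H] := eps_fund; have oO := quad_order_order d r.
have Oe : quad_order d r eps by apply/quad_orderP => //; exists X, Y, s0.
have Oe' : quad_order d r eps^-1.
  apply/quad_orderP => //; exists (s0 * X), (- (s0 * Y)), s0; split; first exact: epsV.
    by rewrite sqrrN !exprMn s0_sqr !mul1r.
  by rewrite rpredN dvdz_mull.
have powO v n : quad_order d r v -> quad_order d r (v ^+ n).
  move=> Ov; elim: n => [|n IH]; first exact: (order1 oO).
  by rewrite exprS; apply: (orderM oO).
have zO (k : int) : quad_order d r (eps ^ k).
  case: k => n; first exact: powO.
  by rewrite NegzE -exprnN -exprVn; apply: powO.
by move=> /H[k [->|->]] //; apply: (orderN oO).
Qed.

(** * Ideals of O_f that become trivial in O_K *)

Section Kernel.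

Variables f r : nat.
Hypothesis pr : prime r.
Hypothesis r2 : r != 2%N.
Hypothesis f_sqf : squarefree f.
Hypothesis f0 : (0 < f)%N.
Hypothesis rf : (r %| f)%N.
Hypothesis rd : (r %| d)%N.
Hypothesis rY : (r%:Z %| Y)%Z.

Let t := (f %/ r)%N.
Let g (k : int) : algC := 1 + (k * t%:Z)%:~R * sd.
Let I (k : int) := gen2 (quad_order d f) (g k) O f%:R.
Let oO := quad_int_order d.
Let oOf := quad_order_order d f.

Lemma kernel_int (k : int) : O (g k).
Proof.
apply: quad_intD; first exact: (quad_int_nat d 1).
by apply: quad_intM; [apply: quad_int_int|apply: sd_int].
Qed.

Lemma f_order w : O w -> quad_order d f (f%:R * w).
Proof. by move=> Ow; exists 0, w; rewrite add0r. Qed.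

Lemma kernel_frac k : fractional_ideal d (quad_order d f) (I k).
Proof.
have fn0 : f%:R != 0 :> algC by rewrite pnatr_eq0 -lt0n.
apply: (gen2_frac oOf oO (@quad_order_sub d f) _ _ fn0 (order_nat f oOf) fn0).
- by have [] := kernel_int k.
- exact: quad_field_nat.
- exact/f_order/kernel_int.
- move=> b Ob; rewrite -mulrA; apply: f_order; apply: quad_intM => //; exact: quad_int_nat.
Qed.

(** The square of (f/r) sqrt d is divisible by f because r divides d. So it is nilpotent modulo f,
    and g(-k) inverts g(k) in O_K / f O_K. *)
Lemma kernel_norm k : exists e : int, g k * g (- k) = 1 - f%:R * e%:~R.
Proof.
exists (k ^+ 2 * t%:Z * (d %/ r)%N%:Z).
have df : (d%:R * t%:R : algC) = f%:R * (d %/ r)%:R.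
  have fE : (t * r)%N = f by apply: divnK.
  by rewrite -!natrM -{1}(divnK rd) -fE; congr (_%:R); lia.
have td (n : nat) : (n%:Z%:~R : algC) = n%:R by [].
rewrite /g !(rmorphN, rmorphXn, rmorphM) /= !td.
transitivity (1 - k%:~R ^+ 2 * t%:R * (d%:R * t%:R) : algC); last by rewrite df; ring.
by move: (sdE d); move: sd => s <-; ring.
Qed.

Lemma kernel_mul k : ideal_mul (I k) (I (- k)) = scale 1 (quad_order d f).
Proof.
have [e ke] := kernel_norm k.
have fK b : O b -> scale 1 (quad_order d f) (f%:R * b) by rewrite scale1; apply: f_order.
apply: (gen2_mul oOf oO (@quad_order_sub d f)); rewrite -/(I k) -/(I (- k)) ?scale1.
- exact: (order_frac oOf).
- exact: kernel_frac.
- exact: kernel_frac.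
- rewrite ke; apply: (orderD oOf); first exact: (order1 oOf).
  by apply: (orderN oOf); apply: f_order; apply: quad_int_int.
- by move=> b Ob; rewrite mulrAC mulrC; apply: f_order; apply: quad_intM => //; apply: kernel_int.
- by move=> b Ob; rewrite -mulrA; apply: f_order; apply: quad_intM => //; apply: kernel_int.
- by move=> b Ob; rewrite -mulrA; apply: f_order; apply: quad_intM => //; apply: quad_int_nat.
have [m0 mD] := ideal_mul_add (I k) (I (- k)).
have [_ _ _ mM _] := mul_frac oOf (kernel_frac k) (kernel_frac (- k)).
have gg : ideal_mul (I k) (I (- k)) (g k * g (- k)).
  by apply: ideal_mul_mem; apply: gen2_mem1.
have fgg : ideal_mul (I k) (I (- k)) (f%:R * g k * g (- k)).
  by apply: ideal_mul_mem; [apply: gen2_mem2 => //; apply: kernel_int|apply: gen2_mem1].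
have ff : ideal_mul (I k) (I (- k)) (f%:R * 1 * (f%:R * 1)).
  by apply: ideal_mul_mem; apply: gen2_mem2 => //; apply: (order1 oO).
(* It is not evident that f lies in the product. With g(k) g(-k) = 1 - f e one has f = f g(k) g(-k)
   + e f^2, and then 1 = g(k) g(-k) + e f. *)
have -> : 1 = g k * g (- k) + e%:~R * (f%:R * g k * g (- k) + e%:~R * (f%:R * 1 * (f%:R * 1))).
  by rewrite -[f%:R * g k * _]mulrA ke; ring.
apply: (mD) => //; apply: (mM); first exact: (order_int e oOf).
by apply: (mD) => //; apply: (mM) => //; exact: (order_int e oOf).
Qed.

Lemma kernel_invertible k : invertible_ideal d (quad_order d f) (I k).
Proof. exact: (invertible_of_mul (c := 1) oOf _ (kernel_frac k) (kernel_frac (- k)) (kernel_mul k)). Qed.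

Lemma kernel_sub k z : I k z -> O z.
Proof.
move=> [a [b [/quad_order_sub Oa Ob ->]]].
by apply: quad_intD; apply: quad_intM => //; [apply: kernel_int|apply: quad_int_nat].
Qed.

(** The elements f and g(k) of [I k] generate the unit ideal of O_K, so a multiplier carrying both
    into O_K is itself integral. Used in both directions, this makes the multiplier a unit. *)
Lemma kernel_scale_int j k u : I j = scale u (I k) -> O u.
Proof.
move=> e; have [c kc] := kernel_norm k.
have Of : O (u * f%:R).
  apply: (@kernel_sub j); rewrite e; apply: scale_mem; rewrite -(mulr1 f%:R).
  by apply: gen2_mem2 => //; apply: (order1 oO).
have Og : O (u * g k) by apply: (@kernel_sub j); rewrite e; apply: scale_mem; apply: gen2_mem1.
have -> : u = u * g k * g (- k) + u * f%:R * c%:~R by rewrite -mulrA kc; ring.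
by apply: quad_intD; apply: quad_intM => //; [apply: kernel_int|apply: quad_int_int].
Qed.

(** The unit u lies in O_r, hence is congruent to an integer modulo r O_K, and so are the
    coefficients from O_f. Therefore g(j) = c g(k) modulo r O_K for an integer c. Comparing
    coordinates gives c = 1 and j t = k t modulo r, and r does not divide t = f/r because f is
    squarefree. *)
Lemma kernel_distinct j k u : u != 0 -> I j = scale u (I k) -> (r%:Z %| j - k)%Z.
Proof.
move=> u0 e; have ro : odd r by apply: contraNT r2 => rE; rewrite -dvdn2 dvdn_prime2 // eq_sym in rE.
have uu : quad_unit d u.
  split; first exact: kernel_scale_int e.
  exists u^-1; last by rewrite divff.
  by apply: (@kernel_scale_int k j); rewrite e scaleA mulVf // scale1.
have [m [w [Ow um]]] := unit_in_order ro rY uu.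
have : I j (g j) by apply: gen2_mem1.
rewrite e => -[_ [a [b [[n [v [Ov ->]]] Ob ->]]] gj].
set c : int := m * n.
have ftr : (f%:R : algC) = r%:R * t%:R by rewrite -natrM mulnC /t divnK.
have [x gx] : exists2 x, O x & g j = c%:~R * g k + r%:R * x.
  exists (n%:~R * (g k * w) + t%:R * (u * (g k * v)) + t%:R * (u * b)).
    have Ou : O u by case: uu.
    have Ogk := kernel_int k.
    do 2 ?[apply: quad_intD]; do 3 ?[apply: quad_intM => //]; by [apply: quad_int_int|apply: quad_int_nat].
  rewrite -gj ftr /c rmorphM /=.
  transitivity (u * (g k * n%:~R) + r%:R * t%:R * u * (g k * v) + u * r%:R * t%:R * b); first by ring.
  by rewrite {1}um; ring.
move: gx => /(quad_intP d_ge2 d_sqf)[A [B [N [-> _]]]] gjk.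
have [e1 e2] : 2 = 2 * c + r%:Z * A /\ 2 * j * t%:Z = 2 * c * k * t%:Z + r%:Z * B.
  apply: (halfz_inj d_ge2 d_sqf).
  transitivity (g j); first by rewrite /halfz /g !rmorphM /=; field.
  rewrite gjk /halfz /g !(rmorphD, rmorphM) /=.
  have -> : (r%:Z%:~R : algC) = r%:R by [].
  by field.
have : (r%:Z %| 2 * ((j - k) * t%:Z))%Z.
  have -> : 2 * ((j - k) * t%:Z) = r%:Z * (B - A * k * t%:Z).
    transitivity (2 * j * t%:Z - (2 * c + r%:Z * A) * k * t%:Z); last by rewrite e2; ring.
    by rewrite -e1; ring.
  exact: dvdz_mulr.
move=> /(dvdz_odd_double pr r2); rewrite Gauss_dvdzl //.
rewrite coprimezE prime_coprime //=; apply/negP => rt.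
by have /negP[] := f_sqf pr; rewrite -(divnK rf) expnS expn1 dvdn_mul.
Qed.

Lemma kernel_too_large : ~ (Pic d (quad_order d f) #= `I_2).
Proof.
move=> Pic2.
have [a [aK a0]] := Pic2_pigeonhole d_ge2 d_sqf Pic2
  (kernel_invertible 0) (kernel_invertible 1) (kernel_invertible 2).
have r3 : (2 < r)%N by rewrite ltn_neqAle eq_sym r2 prime_gt1.
have dis (j : int) : 0 < j -> j <= 2 -> ~~ (r%:Z %| j)%Z.
  by move=> j0 j2; apply/negP; rewrite dvdzE => /dvdn_leq; lia.
by move=> [] /(kernel_distinct a0); apply/negP/dis.
Qed.

End Kernel.

End Ideals.

(** * The order of an odd ramified conductor *)

Lemma prime_dvdzM r (a b : int) : prime r ->
  (r%:Z %| a * b)%Z = (r%:Z %| a)%Z || (r%:Z %| b)%Z.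
Proof. by move=> pr; rewrite !dvdzE abszM Euclid_dvdM. Qed.

(** The solution is a natural number because it will serve as an exponent of eps. *)
Lemma prime_congr_solve r (u v : int) : prime r -> ~~ (r%:Z %| u)%Z ->
  exists j : nat, (r%:Z %| u * j%:Z + v)%Z.
Proof.
move=> pr ru; have cop : coprimez u r%:Z.
  by rewrite coprimezE coprime_sym prime_coprime // -dvdzE.
have [[x y] /= xy] := coprimezP _ _ cop.
have r0 : r%:Z != 0 by have := prime_gt0 pr; lia.
exists `|(- (x * v) %% r%:Z)%Z|%N; rewrite gez0_abs ?modz_ge0 //.
have := divz_eq (- (x * v)) r%:Z; set q := (_ %/ _)%Z; set m := (_ %% _)%Z => e.
apply/dvdzP; exists (y * v - u * q).
have -> : m = - (x * v) - q * r%:Z by rewrite e; ring.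
transitivity (v * (x * u + y * r%:Z) - v * (x * u) - u * q * r%:Z + 0); last by ring.
by rewrite xy; ring.
Qed.

(** * Extension of ideals to a larger order *)

Section Extension.

Variables (d : nat) (O1 O2 : set algC).
Hypothesis oO1 : is_order d O1.
Hypothesis oO2 : is_order d O2.
Hypothesis sO : O1 `<=` O2.

Lemma order_mul_sub : ideal_mul O1 O2 = O2.
Proof.
apply/seteqP; split=> [|z Oz].
  apply: ideal_mul_sub => [|u v Ou Ov]; last by apply: (orderM oO2) => //; apply: sO.
  exact: (frac_add oO2 (order_frac oO2)).
by rewrite -(mul1r z); apply: ideal_mul_mem => //; apply: (order1 oO1).
Qed.

Lemma extension_frac L : fractional_ideal d O1 L -> fractional_ideal d O2 (ideal_mul L O2).
Proof.
move=> fL; have [LK [z Lz z0] LD LM [c [Oc c0 cL]]] := fL.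
have [m0 mD] := ideal_mul_add L O2.
split.
- apply: ideal_mul_sub => [|u v Lu Ov].
    by split; [exact: (quad_field_nat d 0)|exact: quad_fieldD].
  by apply: quad_fieldM; [apply: LK|apply: (order_field oO2)].
- by exists z => //; rewrite -(mulr1 z); apply: ideal_mul_mem => //; apply: (order1 oO2).
- exact: mD.
- move=> a u Oa LOu.
  have : ideal_mul L O2 `<=` [set u | ideal_mul L O2 (a * u)].
    apply: ideal_mul_sub => [|x y Lx Oy /=].
      by split=> [|x y] /=; rewrite ?mulr0 // mulrDr; apply: (mD).
    by rewrite mulrCA; apply: ideal_mul_mem => //; apply: (orderM oO2).
  exact.
- exists c; split=> //; first exact: sO.
  move=> u LOu; have : ideal_mul L O2 `<=` [set u | O2 (c * u)].
    apply: ideal_mul_sub => [|x y Lx Oy /=].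
      split=> [|x y] /=; first by rewrite mulr0; apply: (order0 oO2).
      by rewrite mulrDr; apply: (orderD oO2).
    by rewrite mulrA; apply: (orderM oO2) => //; apply/sO/cL.
  exact.
Qed.

Lemma extension_mul I J : ideal_mul (ideal_mul I O2) (ideal_mul J O2) = ideal_mul (ideal_mul I J) O2.
Proof.
by rewrite -ideal_mulA (ideal_mulA O2) (ideal_mulC O2 J) -(ideal_mulA J) (order_idem oO2) !ideal_mulA.
Qed.

Lemma extension_invertible L : invertible_ideal d O1 L -> invertible_ideal d O2 (ideal_mul L O2).
Proof.
move=> [fL [L' fL' LL']]; split; first exact: extension_frac.
exists (ideal_mul L' O2); first exact: extension_frac.
by rewrite extension_mul LL' order_mul_sub.
Qed.

End Extension.

(** * Descent of principality from O_K to O_r *)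

Section Ramified.

Variable d : nat.
Hypothesis d_ge2 : (2 <= d)%N.
Hypothesis d_sqf : squarefree d.

Local Notation sd := (sqrtC (d%:R : algC)).
Local Notation O := (quad_int d).

Variable eps : algC.
Hypothesis eps_fund : fundamental_unit d eps.
Variables X Y s0 : int.
Hypothesis eps_half : eps = halfz d X Y.
Hypothesis eps_norm : X ^+ 2 - d%:Z * Y ^+ 2 = 4 * s0.
Hypothesis s0_sqr : s0 ^+ 2 = 1.
Variable r : nat.
Hypothesis pr : prime r.
Hypothesis r2 : r != 2%N.
Hypothesis rd : (r %| d)%N.
Hypothesis rY : ~~ (r%:Z %| Y)%Z.

Let oO := quad_int_order d.
Let oOr := quad_order_order d r.

Lemma ramified_odd : odd r.
Proof. by apply: contraNT r2 => rE; rewrite -dvdn2 dvdn_prime2 // eq_sym in rE. Qed.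

Lemma ramified_dvd2 : ~~ (r%:Z %| 2)%Z.
Proof. by rewrite dvdzE /= dvdn_prime2. Qed.

Lemma ramified_dvdd (a : int) : (r%:Z %| d%:Z * a)%Z.
Proof. by apply: dvdz_mulr; rewrite dvdzE. Qed.

Lemma halfzM_coord a b a' b' A B : halfz d a b * halfz d a' b' = halfz d A B ->
  2 * A = a * a' + d%:Z * (b * b') /\ 2 * B = a * b' + b * a'.
Proof.
move=> e; apply: (halfz_inj d_ge2 d_sqf).
have -> : d%:Z * (b * b') = d%:Z * b * b' by ring.
by rewrite -halfzM e /halfz !rmorphM /=; ring.
Qed.

Lemma ramified_ndvd_X : ~~ (r%:Z %| X)%Z.
Proof.
apply/negP => rX; have : (r%:Z %| 2 * (2 * s0))%Z.
  have -> : 2 * (2 * s0) = X * X - d%:Z * Y ^+ 2.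
    by rewrite -expr2 eps_norm; ring.
  by apply: rpredB; [apply: dvdz_mulr|apply: ramified_dvdd].
move=> /(dvdz_odd_double pr r2)/(dvdz_odd_double pr r2) rs.
have : (r%:Z %| s0 ^+ 2)%Z by rewrite expr2; apply: dvdz_mulr.
by rewrite s0_sqr dvdzE dvdn1 /= => /eqP r1; move: pr; rewrite r1.
Qed.

(** Modulo r the element sqrt d is nilpotent, so slopes B/A add under multiplication, and eps^j has
    slope j Y/X. The congruence states this without division. As r does not divide Y, every slope
    occurs. *)
Lemma eps_pow_coord (j : nat) : exists A B, [/\ eps ^ j = halfz d A B,
  (r%:Z %| X * B - j%:Z * Y * A)%Z & ~~ (r%:Z %| A)%Z].
Proof.
elim: j => [|j [A [B [eAB rAB rA]]]].
  exists 2, 0; split; last exact: ramified_dvd2.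
    by rewrite expr0z /halfz; field.
  by rewrite mulr0 !mul0r subrr dvdz0.
have [A' [B' [_ [e' _]]]] := (quad_intP d_ge2 d_sqf _).1 (eps_pow_unit eps_fund j.+1).1.
exists A', B'.
have : halfz d A B * halfz d X Y = halfz d A' B'.
  by rewrite -e' -eAB -eps_half exprSzr.
move=> /halfzM_coord[eA eB]; split=> //.
  apply: (dvdz_odd_double pr r2).
  have -> : 2 * (X * B' - j.+1%:Z * Y * A') =
     X * (X * B - j%:Z * Y * A) - d%:Z * (j.+1%:Z * (B * Y ^+ 2)).
    transitivity (X * (2 * B') - j.+1%:Z * Y * (2 * A')); first by ring.
    by rewrite eA eB -addn1 PoszD; ring.
  by apply: rpredB; [apply: dvdz_mull|apply: ramified_dvdd].
apply/negP => rA'; have : (r%:Z %| A * X)%Z.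
  have -> : A * X = 2 * A' - d%:Z * (B * Y) by rewrite eA; ring.
  by apply: rpredB; [apply: dvdz_mull|apply: ramified_dvdd].
by rewrite prime_dvdzM // (negPf rA) (negPf ramified_ndvd_X).
Qed.

Lemma r_order w : O w -> quad_order d r (r%:R * w).
Proof. by move=> Ow; exists 0, w; rewrite add0r. Qed.

Lemma quad_field_denom z : quad_field d z -> exists n,
  [/\ quad_order d r n, n != 0 & quad_order d r (n * z)].
Proof.
move=> [u [v ->]].
have rn0 : r%:R != 0 :> algC by rewrite pnatr_eq0 -lt0n prime_gt0.
have dn0 (q : rat) : (denq q)%:~R != 0 :> algC by rewrite intr_eq0 denq_neq0.
exists (r%:R * (denq u * denq v)%:~R); rewrite rmorphM /= !mulf_neq0 //.
split=> //.
  by apply: (orderM oOr); [apply: (order_nat _ oOr)|rewrite -rmorphM; apply: (order_int _ oOr)].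
rewrite -mulrA; apply: r_order.
have -> : (denq u)%:~R * (denq v)%:~R * (ratr u + ratr v * sd) =
   (denq v * numq u)%:~R + (denq u * numq v)%:~R * sd :> algC.
  by rewrite /ratr !rmorphM /=; field; rewrite !dn0.
by apply: quad_intD; [|apply: quad_intM; last exact: sd_int]; apply: quad_int_int.
Qed.

(** Modulo r O_K the element g is a nonzero integer, so N contains 1 and hence O_r. As r O_K lies in
    N, any further element would make N equal to O_K; but then O_r = N N' would be stable under
    multiplication by O_K. *)
Lemma order_of_trace N N' g a b : fractional_ideal d (quad_order d r) N ->
  ideal_mul N N' = quad_order d r -> N `<=` O -> (forall w, O w -> N (r%:R * w)) ->
  N g -> g = halfz d a b -> (r%:Z %| b)%Z -> ~~ (r%:Z %| a)%Z -> N = quad_order d r.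
Proof.
move=> fN NN' NO rN Ng eg rb ra; have [_ _ ND NM _] := fN.
have NB u v : N u -> N v -> N (u - v).
  move=> Nu Nv; apply: ND => //; rewrite -mulN1r; apply: NM => //.
  by apply: (orderN oOr); apply: (order1 oOr).
have [n en] : exists n, a ^+ 2 - d%:Z * b ^+ 2 = 4 * n.
  have [a' [b' [n [e1 e2]]]] := (quad_intP d_ge2 d_sqf _).1 (NO _ Ng).
  by move: e1; rewrite eg => /(halfz_inj d_ge2 d_sqf)[-> ->]; exists n.
have [m [w0 [Ow0 gm]]] : quad_order d r g.
  by apply/(quad_orderP d_ge2 d_sqf _ ramified_odd); exists a, b, n.
have rm : ~~ (r%:Z %| m)%Z.
  apply: contra ra => rm.
  have [a1 [b1 [n1 [ew _]]]] := (quad_intP d_ge2 d_sqf _).1 Ow0.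
  have [-> _] : a = 2 * m + r%:Z * a1 /\ b = r%:Z * b1.
    apply: (halfz_inj d_ge2 d_sqf); rewrite -eg gm ew /halfz !(rmorphD, rmorphM) /=.
    by have -> : (r%:Z%:~R : algC) = r%:R by []; field.
  by apply: rpredD; [apply: dvdz_mull|apply: dvdz_mulr].
have Nm : N m%:~R.
  have -> : m%:~R = g - r%:R * w0 by rewrite gm; ring.
  by apply: NB => //; apply: rN.
have N1 : N 1.
  have [j /dvdzP[q e]] := prime_congr_solve (-1) pr rm.
  have -> : 1 = j%:Z%:~R * m%:~R - r%:R * q%:~R :> algC.
    have -> : (r%:R : algC) = r%:Z%:~R by [].
    have e1 : j%:Z * m - r%:Z * q = 1 by rewrite (mulrC r%:Z) -e; ring.
    by rewrite -!rmorphM -rmorphB /= e1.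
  apply: NB; first by apply: NM => //; apply: (order_int _ oOr).
  exact/rN/quad_int_int.
have ON : quad_order d r `<=` N.
  by move=> z Oz; rewrite -(mulr1 z); apply: NM.
apply/seteqP; split=> // h Nh; apply: contrapT => hO.
have [a1 [b1 [n1 [eh en1]]]] := (quad_intP d_ge2 d_sqf _).1 (NO _ Nh).
have rb1 : ~~ (r%:Z %| b1)%Z.
  apply/negP => rb1; apply: hO; apply/(quad_orderP d_ge2 d_sqf _ ramified_odd).
  by exists a1, b1, n1.
have allN : O `<=` N.
  move=> w Ow; have [a2 [b2 [n2 [ew _]]]] := (quad_intP d_ge2 d_sqf _).1 Ow.
  have [c rc] := prime_congr_solve b2 pr rb1.
  have Nch : N (c%:Z%:~R * h) by apply: NM => //; apply: (order_int _ oOr).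
  have -> : w = w + c%:Z%:~R * h - c%:Z%:~R * h by ring.
  apply: NB => //; apply: ON; apply/(quad_orderP d_ge2 d_sqf _ ramified_odd).
  have Ow' : O (w + c%:Z%:~R * h) by apply: quad_intD => //; apply: NO.
  have [a3 [b3 [n3 [e3 en3]]]] := (quad_intP d_ge2 d_sqf _).1 Ow'.
  have [_ eb3] : a3 = a2 + c%:Z * a1 /\ b3 = b1 * c%:Z + b2.
    by apply: (halfz_inj d_ge2 d_sqf); rewrite -e3 ew eh /halfz !(rmorphD, rmorphM) /=; field.
  by exists a3, b3, n3; rewrite {3}eb3.
have OOr : O `<=` quad_order d r.
  move=> w Ow; suff : quad_order d r `<=` [set z | quad_order d r (w * z)].
    by move=> /(_ _ (order1 oOr)); rewrite /= mulr1.
  rewrite -{1}NN'; apply: ideal_mul_sub => [|u v Nu N'v] /=.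
    by split=> [|u v] /=; [rewrite mulr0; apply: (order0 oOr)|rewrite mulrDr; apply: (orderD oOr)].
  rewrite mulrA -NN'; apply: ideal_mul_mem => //.
  by apply: allN; apply: quad_intM => //; apply: NO.
(* In half-integral coordinates sqrt d is (0, 2), and the odd prime r does not divide 2. *)
have := OOr _ (sd_int d) => /(quad_orderP d_ge2 d_sqf _ ramified_odd)[a4 [b4 [n4 [e4 _ rb4]]]].
have [_ eb] : 0 = a4 /\ 2 = b4.
  by apply: (halfz_inj d_ge2 d_sqf); rewrite -e4 /halfz; field.
by move: rb4; rewrite -eb (negPf ramified_dvd2).
Qed.

(** Dividing by a gives M with M O_K = O_K and r O_K inside M. Multiplication by a power of eps
    moves an element of M off the nilpotent line onto the line of the integers modulo r; then
    [order_of_trace] identifies the ideal. *)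
Lemma lift_principal L a : invertible_ideal d (quad_order d r) L -> quad_field d a -> a != 0 ->
  ideal_mul L O = scale a O ->
  exists b, [/\ quad_field d b, b != 0 & L = scale b (quad_order d r)].
Proof.
move=> [fL [L' fL' LL']] aK a0 eL.
have aVK : quad_field d a^-1 by apply: quad_fieldV.
have aV0 : a^-1 != 0 by rewrite invr_eq0.
set M := scale a^-1 L.
have eM : ideal_mul M O = O by rewrite ideal_mul_scale eL scaleA mulVf // scale1.
have fM : fractional_ideal d (quad_order d r) M.
  by apply: scale_frac => //; have [n [? ? ?]] := quad_field_denom aVK; exists n.
have [_ _ _ MM _] := fM.
have MO : M `<=` O by move=> z Mz; rewrite -eM -(mulr1 z); apply: ideal_mul_mem => //; apply: (order1 oO).
have rM w : O w -> M (r%:R * w).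
  rewrite -{1}eM; move: w; change (ideal_mul M O `<=` [set w | M (r%:R * w)]).
  have [M0 MD] := frac_add oOr fM.
  apply: ideal_mul_sub => [|u v Mu Ov] /=.
    by split=> [|u v] /=; rewrite ?mulr0 // mulrDr; apply: MD.
  by rewrite (mulrC u) mulrA; apply: MM => //; apply: r_order.
(* Modulo r the trace of a product is half the product of the traces. If r divided all traces on M,
   it would divide those on M O_K = O_K, including the trace 2 of 1. *)
have [g [a1 [b1 [Mg eg ra1]]]] : exists g a1 b1, [/\ M g, g = halfz d a1 b1 & ~~ (r%:Z %| a1)%Z].
  apply: contrapT => H.
  have : ideal_mul M O `<=` [set z | exists A B, z = halfz d A B /\ (r%:Z %| A)%Z].
    apply: ideal_mul_sub => [|u v Mu Ov] /=.
      split=> [|_ _ [A [B [-> rA]]] [A' [B' [-> rA']]]] /=.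
        by exists 0, 0; rewrite dvdz0 /halfz; split=> //; field.
      exists (A + A'), (B + B'); split; last exact: rpredD.
      by rewrite /halfz !rmorphD /=; field.
    have Ou := MO _ Mu.
    have [A [B [_ [eu _]]]] := (quad_intP d_ge2 d_sqf _).1 Ou.
    have [A' [B' [_ [ev _]]]] := (quad_intP d_ge2 d_sqf _).1 Ov.
    have [A2 [B2 [_ [euv _]]]] := (quad_intP d_ge2 d_sqf _).1 (quad_intM Ou Ov).
    exists A2, B2; split=> //; apply: (dvdz_odd_double pr r2).
    have [-> _] : 2 * A2 = A * A' + d%:Z * (B * B') /\ 2 * B2 = A * B' + B * A'.
      by apply: halfzM_coord; rewrite -eu -ev.
    apply: rpredD; last exact: ramified_dvdd.
    by apply: dvdz_mulr; apply: contrapT => /negP rA; apply: H; exists u, A, B.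
  rewrite eM => /(_ _ (order1 oO))[A [B [e1 rA]]].
  have [eA _] : 2 = A /\ 0 = B.
    by apply: (halfz_inj d_ge2 d_sqf); rewrite -e1 /halfz; field.
  by move: rA; rewrite -eA (negPf ramified_dvd2).
have raY : ~~ (r%:Z %| a1 * Y)%Z by rewrite prime_dvdzM // negb_or ra1.
(* The slope j Y/X of eps^j is to cancel the slope b1/a1 of g. *)
have [j rj] := prime_congr_solve (b1 * X) pr raY.
have [A [B [eAB rAB rA]]] := eps_pow_coord j.
set u := eps ^ j in eAB.
have [Ou [u' Ou' uu']] : quad_unit d u by apply: eps_pow_unit.
have u0 : u != 0 by rewrite expfz_neq0 // (eps_neq0 eps_fund).
have uK : quad_field d u by case: Ou.
set N := scale u M.
have fN : fractional_ideal d (quad_order d r) N.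
  by apply: scale_frac => //; have [n [? ? ?]] := quad_field_denom uK; exists n.
have NN' : ideal_mul N (scale (a / u) L') = quad_order d r.
  rewrite ideal_mul_scale ideal_mul_scaler ideal_mul_scale LL' !scaleA.
  by rewrite [X in scale X _](_ : _ = 1) ?scale1 //; field; rewrite a0 u0.
have NO : N `<=` O by move=> _ [z Mz <-]; apply: quad_intM => //; apply: MO.
have rN w : O w -> N (r%:R * w).
  move=> Ow; have -> : r%:R * w = u * (r%:R * (u' * w)).
    by rewrite mulrCA [u * _]mulrA uu' mul1r.
  by apply: scale_mem; apply: rM; apply: quad_intM.
have Ng : N (u * g) by apply: scale_mem.
have [A2 [B2 [_ [eug _]]]] := (quad_intP d_ge2 d_sqf _).1 (NO _ Ng).
have [eA2 eB2] : 2 * A2 = A * a1 + d%:Z * (B * b1) /\ 2 * B2 = A * b1 + B * a1.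
  by apply: halfzM_coord; rewrite -eAB -eg.
have rB2 : (r%:Z %| B2)%Z.
  apply: (dvdz_odd_double pr r2); rewrite eB2.
  have : (r%:Z %| X * (A * b1 + B * a1))%Z.
    have -> : X * (A * b1 + B * a1) = A * (a1 * Y * j%:Z + b1 * X) + a1 * (X * B - j%:Z * Y * A).
      by ring.
    by apply: rpredD; apply: dvdz_mull.
  by rewrite prime_dvdzM // (negPf ramified_ndvd_X).
have rA2 : ~~ (r%:Z %| A2)%Z.
  apply/negP => rA2; have : (r%:Z %| A * a1)%Z.
    have -> : A * a1 = 2 * A2 - d%:Z * (B * b1) by rewrite eA2; ring.
    by apply: rpredB; [apply: dvdz_mull|apply: ramified_dvdd].
  by rewrite prime_dvdzM // (negPf rA) (negPf ra1).
have eN := order_of_trace fN NN' NO rN Ng eug rB2 rA2.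
exists (a / u); split.
- by apply: quad_fieldM => //; apply: quad_fieldV.
- by rewrite mulf_neq0 // invr_eq0.
rewrite -eN /N /M !scaleA; by rewrite [X in scale X _](_ : _ = 1) ?scale1 //; field; rewrite a0 u0.
Qed.

Variable r' : nat.
Hypothesis pr' : prime r'.
Hypothesis rr' : r != r'.
Hypothesis r'd : (r' %| d)%N.
Hypothesis r'_nsq : no_unit_multiple_square d eps r'.

(** The ideal (r', r sqrt d) of O_r; the factor r is there because sqrt d itself is not in O_r. *)
Let P := gen2 (quad_order d r) r'%:R (quad_order d r) (r%:R * sd).

Lemma ramified_prime_frac : fractional_ideal d (quad_order d r) P.
Proof.
have Orsd : quad_order d r (r%:R * sd) by apply/r_order/sd_int.
have rsd0 : r%:R * sd != 0.
  by rewrite mulf_neq0 ?sqrtC_eq0 ?pnatr_eq0 //; have := prime_gt0 pr; lia.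
apply: (gen2_frac oOr oOr _ _ _ rsd0 (order1 oOr) (oner_neq0 _)) => //.
- exact: quad_field_nat.
- exact: (order_field oOr).
- by rewrite mul1r; apply: (order_nat _ oOr).
- by move=> b Ob; rewrite mul1r; apply: (orderM oOr).
Qed.

(** One has (r sqrt d)^2 = r' e with e = r^2 d/r'. Since d is squarefree and r differs from r', e is
    prime to r', so r' is an integral combination of r'^2 and r' e. *)
Lemma ramified_prime_square : ideal_mul P P = scale r'%:R (quad_order d r).
Proof.
have fP := ramified_prime_frac.
have Orsd : quad_order d r (r%:R * sd) by apply/r_order/sd_int.
have [e eE] : exists e, e = (r ^ 2 * (d %/ r'))%N by eexists.
have rsd2 : r%:R * sd * (r%:R * sd) = r'%:R * e%:R.
  rewrite mulrACA sd_mul -!natrM; congr (_%:R : algC).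
  by rewrite eE -{1}(divnK r'd); lia.
have O1 := order1 oOr.
apply: (gen2_mul oOr oOr _ (scale_nat_frac oOr (prime_gt0 pr')) fP fP) => //.
- by apply: scale_mem; apply: (order_nat _ oOr).
- by move=> b Ob; rewrite -mulrA; apply: scale_mem; apply: (orderM oOr).
- by move=> b Ob; rewrite (mulrC _ r'%:R) -mulrA; apply: scale_mem; apply: (orderM oOr).
- move=> b Ob; rewrite rsd2 -mulrA; apply: scale_mem; apply: (orderM oOr) => //.
  exact: (order_nat _ oOr).
rewrite -/P.
have Pr' : P r'%:R by exact: (gen2_mem1 oOr oOr).
have Prsd : P (r%:R * sd) by rewrite -(mulr1 (_ * sd)); exact: (gen2_mem2 oOr).
have [_ _ mD mM _] := mul_frac oOr fP fP.
have cop : coprimez r'%:Z e%:Z.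
  rewrite coprimezE /= prime_coprime // eE Euclid_dvdM // negb_or Euclid_dvdX //= andbT.
  rewrite dvdn_prime2 // eq_sym rr' /=; apply/negP => r'e.
  by have /negP[] := d_sqf pr'; rewrite -(divnK r'd) expnS expn1 dvdn_mul.
have [[u v] /= uv] := coprimezP _ _ cop.
have -> : r'%:R = u%:~R * (r'%:R * r'%:R) + v%:~R * (r%:R * sd * (r%:R * sd)) :> algC.
  have : (u * r'%:Z + v * e%:Z)%:~R = 1 :> algC by rewrite uv.
  rewrite !(rmorphD, rmorphM) /= -!pmulrn rsd2 => uv1.
  transitivity (r'%:R * (u%:~R * r'%:R + v%:~R * e%:R) : algC); last by ring.
  by rewrite uv1 mulr1.
by apply: mD; apply: (mM); rewrite ?(order_int _ oOr) //; try apply: (order_int _ oOr);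
  apply: ideal_mul_mem.
Qed.

Lemma ramified_prime_nonprincipal g : quad_field d g -> g != 0 -> P <> scale g (quad_order d r).
Proof.
move=> gK g0 Pg; have := ramified_prime_square.
rewrite Pg ideal_mul_scale ideal_mul_scaler scaleA (order_idem oOr) => e.
have r'0 : r'%:R != 0 :> algC by rewrite pnatr_eq0 -lt0n prime_gt0.
have [u Ou gu] : scale r'%:R (quad_order d r) (g * g).
  by rewrite -e -{2}(mulr1 (g * g)); apply: scale_mem; apply: (order1 oOr).
have [v Ov gv] : scale (g * g) (quad_order d r) r'%:R.
  by rewrite e -{2}(mulr1 r'%:R); apply: scale_mem; apply: (order1 oOr).
have uu : quad_unit d u.
  split; [exact: quad_order_sub Ou|exists v; first exact: quad_order_sub Ov].
  by apply: (mulfI r'0); rewrite mulr1 mulrA gu gv.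
apply: (no_unit_multiple_unit eps_fund r'_nsq (prime_gt0 pr') uu gK (quad_field_real gK)).
by rewrite expr2 -gu.
Qed.

Lemma Pic_ramified : Pic d O #= `I_2 -> Pic d (quad_order d r) #= `I_2.
Proof.
move=> Pic2; have fP := ramified_prime_frac.
have iP : invertible_ideal d (quad_order d r) P.
  exact: (invertible_of_mul d_ge2 d_sqf oOr (prime_gt0 pr') fP fP ramified_prime_square).
apply: (Pic2_intro d_ge2 d_sqf oOr iP); first exact: ramified_prime_nonprincipal.
move=> L iL; have sOr := @quad_order_sub d r.
have [a [aK a0 H]] := Pic2_pigeonhole d_ge2 d_sqf Pic2 (order_invertible oO)
  (extension_invertible oOr oO sOr iL) (extension_invertible oOr oO sOr iP).
case: H => [eL|eP|eLP].
- have [b [bK b0 ->]] := lift_principal iL aK a0 eL.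
  by exists b; split=> //; left.
- have [b [bK b0 /(ramified_prime_nonprincipal bK b0)[]]] := lift_principal iP aK a0 eP.
have [fL [L' fL' LL']] := iL.
have iL' : invertible_ideal d (quad_order d r) L' by split=> //; exists L; rewrite // ideal_mulC.
(* P and L have homothetic extensions to O_K, so P L^-1 extends to a principal ideal and descends to
   one. *)
have ePL' : ideal_mul (ideal_mul P L') O = scale a O.
  rewrite -(extension_mul oO) eLP ideal_mul_scale (extension_mul oO) LL'.
  by rewrite (order_mul_sub oOr oO sOr).
have [b [bK b0 eb]] := lift_principal (mul_invertible oOr iP iL') aK a0 ePL'.
exists b^-1; rewrite invr_eq0; split=> //; first exact: quad_fieldV.
right; have := congr1 (fun I => ideal_mul I L) eb.
rewrite /= -ideal_mulA (ideal_mulC L') LL' ideal_mulC (ideal_mul1 oOr fP) => ->.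
by rewrite ideal_mul_scale (ideal_mul1 oOr fL) scaleA mulVf // scale1.
Qed.

End Ramified.

(** * Square roots of 2 and -2 modulo primes *)

(** With k^2 < m < (k+1)^2, the pairs (i, j) with 0 <= i, j <= k outnumber the residues modulo m, so
    two of them share the value i - c j. That m is not a square makes the bounds strict. *)
Lemma thue (m : nat) (c : int) : (0 < m)%N -> (forall s, m <> (s ^ 2)%N) ->
  exists x z : int, [/\ (x != 0) || (z != 0), x ^+ 2 < m%:Z, z ^+ 2 < m%:Z & (m%:Z %| x - c * z)%Z].
Proof.
move=> m0 msq.
have [k km mk] : exists2 k, (k ^ 2 < m)%N & (m < k.+1 ^ 2)%N.
  have ex : exists i, (m < i.+1 ^ 2)%N by exists m; rewrite expnS expn1; lia.
  exists (ex_minn ex); case: ex_minnP => // -[|i] mi imin //.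
  rewrite ltn_neqAle; apply/andP; split; first by apply/eqP => /esym/msq.
  by rewrite leqNgt; apply/negP => /imin; rewrite ltnn.
pose f (ij : 'I_k.+1 * 'I_k.+1) : 'I_m :=
  Ordinal (ltn_pmod `|((ij.1%:Z - c * ij.2%:Z) %% m%:Z)%Z|%N m0).
have : ~~ injectiveb f.
  apply/negP => /injectiveP /leq_card.
  by rewrite card_prod !card_ord leqNgt; move: mk; rewrite expnS expn1 => ->.
move=> /injectivePn[[i j] [[i' j'] ne /(congr1 val) /= e]].
exists (i%:Z - i'%:Z), (j%:Z - j'%:Z); split.
- apply/negPn/negP; rewrite negb_or !negbK => /andP[/eqP ei /eqP ej].
  by case/eqP: ne; congr (_, _); apply: val_inj => /=; lia.
- have [? ?] := (ltn_ord i, ltn_ord i'); nia.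
- have [? ?] := (ltn_ord j, ltn_ord j'); nia.
have m0' : m%:Z != 0 by lia.
have modm (z : int) : (`|(z %% m%:Z)%Z| %% m)%N%:Z = (z %% m%:Z)%Z.
  rewrite modn_small ?gez0_abs ?modz_ge0 //.
  by have := ltz_mod z m0'; have := modz_ge0 z m0'; lia.
have := congr1 Posz e; rewrite !modm => /eqP.
rewrite eqz_mod_dvd; congr (_ %| _)%Z; ring.
Qed.

(** Thue's pair gives a multiple of m strictly between 0 and 3m. If it is 2m, then x = 2y and z^2 +
    2 y^2 = m. *)
Lemma thue_sqr_add_2sqr (m : nat) (c : int) : (forall s, m <> (s ^ 2)%N) -> (0 < m)%N ->
  odd m -> (m%:Z %| c ^+ 2 + 2)%Z -> exists x z : int, x ^+ 2 + 2 * z ^+ 2 = m%:Z.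
Proof.
move=> msq m0 modd mc; have [x [z [xz xm zm mxz]]] := thue c m0 msq.
have : (m%:Z %| x ^+ 2 + 2 * z ^+ 2)%Z.
  have -> : x ^+ 2 + 2 * z ^+ 2 = (x - c * z) * (x + c * z) + (c ^+ 2 + 2) * z ^+ 2 by ring.
  by apply: rpredD; apply: dvdz_mulr.
move=> /dvdzP[q e].
have pos : 0 < x ^+ 2 + 2 * z ^+ 2 by nia.
have [q1|q2] : q = 1 \/ q = 2.
  have q0 : 0 < q by rewrite -(pmulr_lgt0 q (x := m%:Z)) ?ltz_nat // -e.
  have q3 : q < 3 by rewrite -(ltr_pM2r (x := m%:Z)) ?ltz_nat // -e; move: xm zm; clear; lia.
  by move: q0 q3; clear; lia.
  by exists x, z; rewrite e q1 mul1r.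
have [y [xy|xy]] := int_parity x; last by move: e; rewrite q2 xy; clear; lia.
exists z, y; move: e; rewrite q2 xy; clear; lia.
Qed.

(** Thue's pair gives a multiple of m strictly between -2m and m, nonzero by the irrationality of
    the square root of 2; hence it is -m. *)
Lemma thue_2sqr_sub_sqr (m : nat) (c : int) : (forall s, m <> (s ^ 2)%N) -> (0 < m)%N ->
  (m%:Z %| c ^+ 2 - 2)%Z -> exists x z : int, 2 * z ^+ 2 - x ^+ 2 = m%:Z.
Proof.
move=> msq m0 mc; have [x [z [xz xm zm mxz]]] := thue c m0 msq.
have : (m%:Z %| x ^+ 2 - 2 * z ^+ 2)%Z.
  have -> : x ^+ 2 - 2 * z ^+ 2 = (x - c * z) * (x + c * z) + (c ^+ 2 - 2) * z ^+ 2 by ring.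
  by apply: rpredD; apply: dvdz_mulr.
move=> /dvdzP[q e].
have nz : x ^+ 2 - 2 * z ^+ 2 != 0.
  apply/eqP => e0; have xz2 : x ^+ 2 = 2 * z ^+ 2 by lia.
  have z0 : z != 0.
    by apply/eqP => z0; move: xz xz2; rewrite z0 eqxx orbF expr0n mulr0;
      move=> /negPf x0 /eqP; rewrite sqrf_eq0 x0.
  have zQ : z%:~R != 0 :> rat by rewrite intr_eq0.
  have /rat_sqr_nat[s] : (x%:~R / z%:~R : rat) ^+ 2 = 2%:R.
    by rewrite expr_div_n -rmorphXn /= xz2 rmorphM rmorphXn /= mulfK // sqrf_eq0.
  by case: s => [|[|s]] //; rewrite expnS expn1; clear; lia.
have q1 : q < 1 by rewrite -(ltr_pM2r (x := m%:Z)) ?ltz_nat // -e; move: xm zm (sqr_ge0 z); clear; lia.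
have q2 : -2 < q by rewrite -(ltr_pM2r (x := m%:Z)) ?ltz_nat // -e; move: xm zm (sqr_ge0 x); clear; lia.
have q0 : q != 0 by apply: contraNneq nz => q0; rewrite e q0 mul0r.
have qE : q = -1 by move: q0 q1 q2; clear; lia.
by exists x, z; move: e; rewrite qE; clear; lia.
Qed.

Lemma Fp_int_eq0 p (a : int) : prime p -> (a%:~R == 0 :> 'F_p) = (p%:Z %| a)%Z.
Proof.
move=> pp; have nat0 (n : nat) : (n%:R == 0 :> 'F_p) = (p %| n)%N.
  by rewrite (dvdn_pcharf (pchar_Fp pp)).
case: a => n; first by rewrite nat0 dvdzE.
by rewrite NegzE mulrNz oppr_eq0 nat0 dvdzE abszN.
Qed.

Lemma Fp_square p (x : 'F_p) (e : int) : prime p -> x ^+ 2 = 2 * e%:~R ->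
  exists c : int, (p%:Z %| c ^+ 2 - 2 * e)%Z.
Proof.
move=> pp xe; exists (val x)%:Z; rewrite -Fp_int_eq0 //.
rewrite rmorphB rmorphXn rmorphM /=; have -> : (val x)%:Z%:~R = x :> 'F_p by apply: natr_Zp.
by rewrite xe subrr.
Qed.

Lemma Fp_fermat p (x : 'F_p) : prime p -> x != 0 -> x ^+ p.-1 = 1.
Proof.
move=> pp x0; have := expf_card x; rewrite card_Fp // => e.
by apply: (mulfI x0); rewrite -exprS prednK ?prime_gt0 // mulr1.
Qed.

Lemma Fp_half_power p (x : 'F_p) n : prime p -> x != 0 -> p = n.*2.+1 -> x ^+ n = 1 \/ x ^+ n = -1.
Proof.
move=> pp x0 pn; have pE : p.-1 = (n * 2)%N by lia.
have := Fp_fermat pp x0; rewrite pE exprM => /eqP.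
by rewrite sqrf_eq1 => /orP[/eqP|/eqP]; [left|right].
Qed.

(** For z with z^4 = -1, a primitive eighth root of unity, z^-1 = -z^3, and z + z^-1 and z - z^-1
    square to 2 and -2. *)
Lemma sqrt_pm2_mod8_1 p (e : int) : prime p -> p = 1 %[mod 8] -> e ^+ 2 = 1 ->
  exists c : int, (p%:Z %| c ^+ 2 - 2 * e)%Z.
Proof.
move=> pp p8 e1; pose k := (p %/ 8)%N.
have pk : p = (4 * k).*2.+1 by rewrite /k; have := prime_gt1 pp; lia.
have k0 : (0 < k)%N by have := prime_gt1 pp; lia.
(* A nonresidue exists: X^(4k) - 1 has at most 4k roots, while there are 8k nonzero residues. *)
have [g g0 gn] : exists2 g : 'F_p, g != 0 & g ^+ (4 * k) = -1.
  apply: contrapT => H.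
  have all1 (g : 'F_p) : g != 0 -> g ^+ (4 * k) = 1.
    move=> g0; have [//|gn] := Fp_half_power pp g0 pk.
    by case: H; exists g.
  have := @max_poly_roots _ ('X^(4 * k) - 1%:P) (enum (predC1 (0 : 'F_p))).
  rewrite -size_poly_eq0 size_XnsubC ?muln_gt0 // enum_uniq => /(_ isT _ isT).
  have -> : all (root ('X^(4 * k) - 1%:P)) (enum (predC1 (0 : 'F_p))).
    apply/allP => x; rewrite mem_enum => x0.
    by rewrite rootE !(hornerD, hornerN, hornerXn, hornerC) all1 // subrr.
  by rewrite -cardE cardC1 card_Fp // => /(_ isT); lia.
pose z := g ^+ k.
have z4 : z ^+ 4 = -1 by rewrite /z -exprM mulnC.
have [E|E] : e = 1 \/ e = -1 by nia.
  apply: (@Fp_square _ (z - z ^+ 3)) => //; rewrite E.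
  transitivity (z ^+ 2 - 2 * z ^+ 4 + z ^+ 2 * z ^+ 4); first by ring.
  by rewrite z4; ring.
apply: (@Fp_square _ (z + z ^+ 3)) => //; rewrite E.
transitivity (z ^+ 2 + 2 * z ^+ 4 + z ^+ 2 * z ^+ 4); first by ring.
by rewrite z4; ring.
Qed.

(** Write p = 4k + 3. As (p - 1)/2 = 2k + 1 is odd, one x among 2 and -2 satisfies x^(2k+1) = 1, and
    then x^(k+1) is a square root of x. *)
Lemma sqrt_pm2_mod4_3 p : prime p -> p = 3 %[mod 4] ->
  exists e : int, e ^+ 2 = 1 /\ exists c : int, (p%:Z %| c ^+ 2 - 2 * e)%Z.
Proof.
move=> pp p4; pose k := (p %/ 4)%N.
have pk : p = (2 * k).+1.*2.+1 by rewrite /k; lia.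
have t0 : 2 != 0 :> 'F_p.
  by rewrite (_ : 2 = 2%:Z%:~R) // Fp_int_eq0 // dvdzE dvdn_prime2 //; apply/eqP; lia.
have sq (x : 'F_p) : x ^+ (2 * k).+1 = 1 -> (x ^+ k.+1) ^+ 2 = x.
  have k2 : (k.+1 * 2)%N = (2 * k).+2 by clear; lia.
  by move=> x1; rewrite -exprM k2 exprS x1 mulr1.
have [t1|t1] := Fp_half_power pp t0 pk.
  by exists 1; split=> //; apply: (@Fp_square _ (2 ^+ k.+1)) => //; rewrite sq // mulr1.
exists (-1); split=> //; apply: (@Fp_square _ ((- 2) ^+ k.+1)) => //.
rewrite sq ?mulrN1z; first by rewrite mulrN1.
by rewrite exprNn t1 -signr_odd /= mul2n odd_double expr1 mulrNN mulr1.
Qed.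

(** If 2 were a square modulo p, then p = 2 z^2 - x^2 with x odd, which is 1 or 7 modulo 8. *)
Lemma sqrt_m2_mod8_3 p : prime p -> p = 3 %[mod 8] -> exists c : int, (p%:Z %| c ^+ 2 + 2)%Z.
Proof.
move=> pp p8; have [|e [e1 [c pc]]] := sqrt_pm2_mod4_3 pp; first by lia.
have [E|E] : e = 1 \/ e = -1 by nia.
  have psq s : p <> (s ^ 2)%N by apply: (nonsquare_prime pp) => //; apply: prime_sqr_ndvd.
  have [x [z xz]] : exists x z : int, 2 * z ^+ 2 - x ^+ 2 = p%:Z.
    by apply: (thue_2sqr_sub_sqr (c := c)) => //; [apply: prime_gt0|move: pc; rewrite E mulr1].
  have [k pk] : exists k, p%:Z = 8 * k + 3 by exists (p %/ 8)%N%:Z; move: p8; clear; lia.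
  exfalso; move: xz; rewrite pk; have [y [->|->]] := int_parity x; first by clear; lia.
  by have [w [->|->]] := int_parity z; have [v [->|->]] := int_parity y; clear; lia.
by exists c; move: pc; rewrite E; congr (_ %| _)%Z; ring.
Qed.

Lemma sqrt_crt p q (e a b : int) : prime p -> prime q -> p != q ->
  (p%:Z %| a ^+ 2 - e)%Z -> (q%:Z %| b ^+ 2 - e)%Z ->
  exists c : int, ((p * q)%N%:Z %| c ^+ 2 - e)%Z.
Proof.
move=> pp pq npq pa qb; have cop : coprimez p%:Z q%:Z.
  by rewrite coprimezE prime_coprime // dvdn_prime2.
exists (zchinese p%:Z q%:Z a b); rewrite PoszM Gauss_dvdz //.
have sqr (m c c' : int) : (c = c' %[mod m])%Z -> (m %| c' ^+ 2 - e)%Z -> (m %| c ^+ 2 - e)%Z.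
  move=> /eqP; rewrite eqz_mod_dvd => cc me.
  have -> : c ^+ 2 - e = (c - c') * (c + c') + (c' ^+ 2 - e) by ring.
  by apply: rpredD => //; apply: dvdz_mulr.
by rewrite (sqr _ _ _ (zchinese_modl cop a b) pa) (sqr _ _ _ (zchinese_modr cop a b) qb).
Qed.

(** * The prime above 2 *)

Lemma int_sqr1 (e : int) : e ^+ 2 = 1 -> e = 1 \/ e = -1.
Proof. by move=> /eqP; rewrite sqrf_eq1 => /orP[/eqP|/eqP]; [left|right]. Qed.

Lemma two_sqr_rep (d m : nat) (c e : int) : (d = m \/ d = 2 * m)%N -> odd m ->
  (forall s, m <> (s ^ 2)%N) -> e ^+ 2 = 1 -> (m%:Z %| c ^+ 2 - 2 * e)%Z ->
  exists x z e' : int, e' ^+ 2 = 1 /\ x ^+ 2 - d%:Z = 2 * e' * z ^+ 2.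
Proof.
move=> dm modd msq e1 mc; have m0 : (0 < m)%N by case: m modd {dm msq mc}.
have [E|E] := int_sqr1 e1.
  have [x [z xz]] : exists x z : int, 2 * z ^+ 2 - x ^+ 2 = m%:Z.
    by apply: (thue_2sqr_sub_sqr (c := c)) => //; move: mc; rewrite E mulr1.
  case: dm => ->; last by exists (2 * z), x, 1; rewrite PoszM -xz; split=> //; ring.
  (* The identity (x + 2z)^2 - (2 z^2 - x^2) = 2 (x + z)^2. *)
  by exists (x + 2 * z), (x + z), 1; rewrite -xz; split=> //; ring.
have [x [z xz]] : exists x z : int, x ^+ 2 + 2 * z ^+ 2 = m%:Z.
  by apply: (thue_sqr_add_2sqr (c := c)) => //; move: mc; rewrite E; congr (_ %| _)%Z; ring.
case: dm => ->; last by exists (2 * z), x, (-1); rewrite PoszM -xz; split=> //; ring.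
by exists x, z, (-1); rewrite -xz; split=> //; ring.
Qed.

Section TwoNorm.

Variable d : nat.
Hypothesis d_ge2 : (2 <= d)%N.
Hypothesis d_sqf : squarefree d.
Hypothesis d_mod4 : (d %% 4 != 1)%N.

Local Notation sd := (sqrtC (d%:R : algC)).
Local Notation O := (quad_int d).

Lemma d_mod4_23 : exists k : int, d%:Z = 4 * k + 2 \/ d%:Z = 4 * k + 3.
Proof.
exists (d %/ 4)%N%:Z.
have d4 : (d %% 4 != 0)%N by have := d_sqf (p := 2) isT; rewrite expnS expn1 /dvdn.
by move: d4 d_mod4; clear; lia.
Qed.

Lemma quad_int_coord z : O z -> exists u v : int, z = u%:~R + v%:~R * sd.
Proof.
move=> /(quad_intP d_ge2 d_sqf)[a [b [n [-> e]]]].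
have [k dk] := d_mod4_23.
have [u ua] := int_parity a; have [v vb] := int_parity b.
have [ea eb] : a = 2 * u /\ b = 2 * v.
  move: e; case: ua => ->; case: vb => ->; case: dk => ->; by [split|clear; lia].
by exists u, v; rewrite ea eb /halfz !rmorphM /=; field.
Qed.

Lemma normK_coord (u v : int) : normK d (u%:~R + v%:~R * sd) = (u ^+ 2 - d%:Z * v ^+ 2)%:~R.
Proof.
have := normKE d_ge2 d_sqf u%:~R v%:~R; rewrite !ratr_int => ->.
by rewrite rmorphB rmorphXn rmorphM rmorphXn.
Qed.

Variables x z e : int.
Hypothesis e_sqr : e ^+ 2 = 1.
Hypothesis rep : x ^+ 2 - d%:Z = 2 * e * z ^+ 2.

(** An even z would make d a square modulo 4, which 2 and 3 are not. *)
Lemma rep_odd : ~~ (2 %| z)%Z.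
Proof.
apply/negP => /dvdzP[w zw]; have [k dk] := d_mod4_23; move: rep; rewrite zw.
have [u xu] := int_parity x.
by case: dk => ->; case: xu => ->; case: (int_sqr1 e_sqr) => ->; clear; lia.
Qed.

Lemma rep_coprime : coprimez z (2 * x).
Proof.
rewrite coprimezE; apply: contraT => ncop.
have z0 : z != 0 by apply: contraNneq rep_odd => ->.
have g1 : (1 < gcdn `|z|%N `|(2 * x)%R|%N)%N.
  rewrite ltn_neqAle eq_sym ncop gcdn_gt0 absz_gt0 z0 //.
have [l pl lg] := pdivP g1.
have lz : (l%:Z %| z)%Z by rewrite dvdzE; apply: dvdn_trans lg (dvdn_gcdl _ _).
have l2 : l != 2%N by apply: contraNneq rep_odd => l2; move: lz; rewrite l2.
have lx : (l%:Z %| x)%Z.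
  by apply: (dvdz_odd_double pl l2); rewrite dvdzE; apply: dvdn_trans lg (dvdn_gcdr _ _).
have : ((l ^ 2)%N%:Z %| d%:Z)%Z.
  have -> : d%:Z = x ^+ 2 - 2 * e * z ^+ 2 by rewrite -rep; ring.
  have lsq (w : int) : (l%:Z %| w)%Z -> ((l ^ 2)%N%:Z %| w ^+ 2)%Z.
    by move=> lw; rewrite expnS expn1 PoszM expr2; apply: dvdz_mul.
  by apply: rpredB; [|apply: dvdz_mull]; apply: lsq.
by rewrite dvdzE; have /negP := d_sqf pl.
Qed.

Let zn := `|z|%N.
Let alpha : algC := x%:~R + sd.
Let J := gen2 O zn%:R O alpha.
Let oO := quad_int_order d.

Lemma zn_gt0 : (0 < zn)%N.
Proof. by rewrite absz_gt0; apply: contraNneq rep_odd => ->. Qed.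

Lemma zn_sqr : (zn%:R : algC) ^+ 2 = z%:~R ^+ 2.
Proof.
have [zE|zE] : z = zn%:Z \/ z = - zn%:Z by rewrite /zn; clear; lia.
  by rewrite [in RHS]zE.
by rewrite [in RHS]zE rmorphN /= sqrrN.
Qed.

Lemma zn_bezout : exists w v : int, w%:~R * zn%:R + v%:~R * (2 * x%:~R) = 1 :> algC.
Proof.
have [[u v] /= uv] := coprimezP _ _ rep_coprime.
have uvC : u%:~R * z%:~R + v%:~R * (2 * x%:~R) = 1 :> algC.
  transitivity ((u * z + v * (2 * x))%:~R : algC); last by rewrite uv.
  by rewrite !(rmorphD, rmorphM).
have [zE|zE] : z = zn%:Z \/ z = - zn%:Z by rewrite /zn; clear; lia.
  by exists u, v; rewrite -[RHS]uvC [in RHS]zE.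
exists (- u), v; rewrite -[RHS]uvC; congr (_ + _).
by rewrite [in RHS]zE !rmorphN /= mulrN mulNr.
Qed.

Lemma alpha_int : O alpha.
Proof. by apply: quad_intD; [apply: quad_int_int|apply: sd_int]. Qed.

Lemma conj_int : O (x%:~R - sd).
Proof. by apply: quad_intD; [apply: quad_int_int|apply/quad_intN/sd_int]. Qed.

Lemma alpha_conj : alpha * (x%:~R - sd) = 2 * e%:~R * zn%:R ^+ 2.
Proof.
rewrite zn_sqr; transitivity ((x ^+ 2 - d%:Z)%:~R : algC).
  rewrite rmorphB rmorphXn /= -pmulrn /alpha.
  by move: (sdE d); move: sd => s <-; ring.
by rewrite rep rmorphM rmorphXn rmorphM.
Qed.

Lemma gen2_quad_frac g h : O g -> O h -> h != 0 -> fractional_ideal d O (gen2 O g O h).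
Proof.
move=> Og Oh h0; apply: (gen2_frac oO oO _ _ _ h0 (order1 oO) (oner_neq0 _)) => //.
- exact: (order_field oO).
- exact: (order_field oO).
- by rewrite mul1r.
- by move=> b Ob; rewrite mul1r; apply: quad_intM.
Qed.

Lemma sd_add_neq0 (w : int) (s : int) : s != 0 -> w%:~R + s%:~R * sd != 0.
Proof.
move=> s0; apply/eqP; rewrite -(ratr_int _ w) -(ratr_int _ s) => /(sd_free d_ge2 d_sqf)[_ /eqP].
by rewrite intr_eq0 (negPf s0).
Qed.

Lemma J_frac : fractional_ideal d O J.
Proof.
apply: gen2_quad_frac; [exact: quad_int_nat|exact: alpha_int|].
by have := @sd_add_neq0 x 1 isT; rewrite mul1r.
Qed.

(** J times its conjugate is zO: all products of generators are multiples of z, and z is a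
    combination of z^2 and z (alpha + conj) = 2xz because z is prime to 2x. *)
Lemma J_invertible : invertible_ideal d O J.
Proof.
have fJ' : fractional_ideal d O (gen2 O zn%:R O (x%:~R - sd)).
  apply: gen2_quad_frac; [exact: quad_int_nat|exact: conj_int|].
  by have := @sd_add_neq0 x (-1) isT; rewrite mulN1r.
have Oz := quad_int_nat d zn.
have inz w : O w -> scale zn%:R O (zn%:R * w) by apply: scale_mem.
apply: (invertible_of_mul d_ge2 d_sqf oO zn_gt0 J_frac fJ').
apply: (gen2_mul oO oO _ (scale_nat_frac oO zn_gt0) J_frac fJ') => //; first exact: inz.
- by move=> b Ob; rewrite -mulrA; apply: inz; apply: quad_intM => //; apply: conj_int.
- by move=> b Ob; rewrite (mulrC alpha) -mulrA; apply: inz; apply: quad_intM => //; apply: alpha_int.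
- move=> b Ob; rewrite alpha_conj.
  have -> : 2 * e%:~R * zn%:R ^+ 2 * b = zn%:R * ((2 * e)%:~R * zn%:R * b) by rewrite rmorphM /=; ring.
  by apply: inz; apply: quad_intM => //; apply: quad_intM => //; apply: quad_int_int.
rewrite -/J; set J' := gen2 _ _ _ _.
have [_ _ mD mM _] := mul_frac oO J_frac fJ'.
have Jz : J zn%:R by exact: (gen2_mem1 oO oO).
have J'z : J' zn%:R by exact: (gen2_mem1 oO oO).
have Ja : J alpha by rewrite -(mulr1 alpha); apply: (gen2_mem2 oO); exact: (order1 oO).
have J'a : J' (x%:~R - sd) by rewrite -(mulr1 (_ - _)); apply: (gen2_mem2 oO); exact: (order1 oO).
have [w [v wv]] := zn_bezout.
have -> : zn%:R = w%:~R * (zn%:R * zn%:R) + v%:~R * (zn%:R * (x%:~R - sd) + alpha * zn%:R) :> algC.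
  by rewrite -[LHS]mulr1 -[X in _ * X]wv /alpha; ring.
apply: (mD); apply: (mM); try exact: quad_int_int; first exact: ideal_mul_mem.
by apply: (mD); apply: ideal_mul_mem.
Qed.

(** Here 2x alpha = alpha^2 + alpha conj = alpha^2 + 2 e z^2 and z alpha both lie in J^2; the Bezout
    relation for z and 2x combines them into alpha. *)
Lemma alpha_in_JJ : ideal_mul J J alpha.
Proof.
have [_ _ mD mM _] := mul_frac oO J_frac J_frac.
have Jz : J zn%:R by exact: (gen2_mem1 oO oO).
have Ja : J alpha by rewrite -(mulr1 alpha); apply: (gen2_mem2 oO); exact: (order1 oO).
have [w [v wv]] := zn_bezout.
have -> : alpha = w%:~R * (zn%:R * alpha) +
    v%:~R * (alpha * alpha + (2 * e)%:~R * (zn%:R * zn%:R)).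
  rewrite rmorphM -(expr2 zn%:R) -alpha_conj.
  by rewrite -[LHS]mulr1 -[X in _ * X]wv /alpha; ring.
have mJ a b : J a -> J b -> ideal_mul J J (a * b) by exact: ideal_mul_mem.
apply: (mD); apply: (mM); try exact: quad_int_int; first exact: mJ.
by apply: (mD); first exact: mJ; apply: (mM); [exact: quad_int_int|exact: mJ].
Qed.

(** J^2 lies in z^2 O + alpha O, and N(z^2 a + alpha b) is congruent to N(alpha) N(b) = 2 e z^2 N(b)
    modulo z^2. *)
Lemma JJ_norm g : ideal_mul J J g -> exists u v : int,
  g = u%:~R + v%:~R * sd /\ (z ^+ 2 %| u ^+ 2 - d%:Z * v ^+ 2)%Z.
Proof.
have : ideal_mul J J `<=` [set g | exists a b, [/\ O a, O b & g = zn%:R ^+ 2 * a + alpha * b]].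
  apply: ideal_mul_sub => [|_ _ [a [b [Oa Ob ->]]] [a' [b' [Oa' Ob' ->]]]] /=.
    split=> [|_ _ [a [b [Oa Ob ->]]] [a' [b' [Oa' Ob' ->]]]] /=.
      by exists 0, 0; rewrite !mulr0 addr0; split=> //; exact: (order0 oO).
    by exists (a + a'), (b + b'); split; [exact: quad_intD|exact: quad_intD|ring].
  exists (a * a'), (zn%:R * (a * b' + b * a') + alpha * (b * b')); split.
  - exact: quad_intM.
  - apply: quad_intD; apply: quad_intM; [exact: quad_int_nat| |exact: alpha_int|exact: quad_intM].
    by apply: quad_intD; apply: quad_intM.
  - by ring.
move=> sub /sub[a [b [/quad_int_coord[u1 [u2 ->]] /quad_int_coord[v1 [v2 ->]] ->]]].
exists (z ^+ 2 * u1 + (x * v1 + d%:Z * v2)), (z ^+ 2 * u2 + (v1 + x * v2)); split.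
  rewrite zn_sqr /alpha !(rmorphD, rmorphXn, rmorphM) /= -pmulrn.
  by move: (sdE d); move: sd => s <-; ring.
apply/dvdzP; exists (z ^+ 2 * u1 ^+ 2 + 2 * u1 * (x * v1 + d%:Z * v2)
  - d%:Z * (z ^+ 2 * u2 ^+ 2 + 2 * u2 * (v1 + x * v2)) + 2 * e * (v1 ^+ 2 - d%:Z * v2 ^+ 2)).
rewrite mulrDl -[2 * e * _ * _]mulrAC -rep; ring.
Qed.

(** Let J^2 = gO and N(g) = c z^2. From alpha = g b follows c N(b) = 2e, and from z^2 = g t follows
    c N(t) = z^2. So c divides both 2 and the odd number z^2, hence is 1 or -1, and b is the element
    wanted. *)
Lemma two_norm : Pic d O #= `I_2 ->
  exists a b e' : int, e' ^+ 2 = 1 /\ a ^+ 2 - d%:Z * b ^+ 2 = 2 * e'.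
Proof.
move=> Pic2; have [g [gK g0 eJJ]] := Pic2_square d_ge2 d_sqf oO Pic2 J_invertible.
have JJg : ideal_mul J J g by rewrite eJJ; exists 1; [exact: (order1 oO)|rewrite mulr1].
have [u [v [gE /dvdzP[c gN]]]] := JJ_norm JJg.
have [b Ob ab] : scale g O alpha by rewrite -eJJ; apply: alpha_in_JJ.
have [t Ot zt] : scale g O (zn%:R * zn%:R).
  by rewrite -eJJ; apply: ideal_mul_mem; exact: (gen2_mem1 oO oO).
have [b1 [b2 bE]] := quad_int_coord Ob; have [t1 [t2 tE]] := quad_int_coord Ot.
set nb := b1 ^+ 2 - d%:Z * b2 ^+ 2; set nt := t1 ^+ 2 - d%:Z * t2 ^+ 2.
have z20 : z ^+ 2 != 0 by rewrite sqrf_eq0; apply: contraNneq rep_odd => ->.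
have nab : c * nb = 2 * e.
  apply: (mulIf z20); rewrite -rep mulrAC -gN.
  apply: (@intr_inj rat); rewrite rmorphM /= -normK_coord -gE -normK_coord -bE.
  rewrite -normKM ?ab //; last by case: Ob.
  have -> : alpha = x%:~R + 1%:~R * sd by rewrite mul1r.
  by rewrite normK_coord expr1n mulr1.
have nzt : c * nt = z ^+ 2.
  apply: (mulIf z20); rewrite mulrAC -gN.
  apply: (@intr_inj rat); rewrite rmorphM /= -normK_coord -gE -normK_coord -tE.
  rewrite -normKM ?zt //; last by case: Ot.
  have -> : zn%:R * zn%:R = (z ^+ 2)%:~R + 0%:~R * sd.
    by rewrite mul0r addr0 -expr2 zn_sqr rmorphXn.
  by rewrite normK_coord expr0n mulr0 subr0 expr2.
have c1 : c = 1 \/ c = -1.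
  have cd2 : (`|c| %| 2)%N.
    have := congr1 absz nab; rewrite !abszM.
    have -> : `|e|%N = 1%N by case: (int_sqr1 e_sqr) => ->.
    by rewrite muln1 => nab2; have -> : 2%N = (`|c|%N * `|nb|%N)%N by []; apply: dvdn_mulr.
  have c2 : `|c|%N != 2%N.
    apply/eqP => c2; have : (2 %| z ^+ 2)%Z.
      by rewrite -nzt; apply: dvdz_mulr; rewrite dvdzE c2.
    by rewrite expr2 prime_dvdzM // (negPf rep_odd).
  have := @dvdn_leq _ 2 isT cd2; have := @dvdn_gt0 _ 2 isT cd2; move: c2; clear; lia.
exists b1, b2, (c * e); have cc : c ^+ 2 = 1 by case: c1 => ->.
rewrite exprMn cc e_sqr; split=> //; rewrite -/nb.
transitivity (c ^+ 2 * nb); first by rewrite cc mul1r.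
by rewrite expr2 -mulrA nab; ring.
Qed.

End TwoNorm.

(** * The theorem *)

Lemma kronecker_prime0 (n p : nat) : prime p -> kronecker n p = 0 <-> (p %| n)%N.
Proof.
move=> pp; have p0 := prime_gt0 pp.
rewrite /kronecker ifN ?eqz_nat -?lt0n //= mul1r prime_decompE primes_prime // big_seq1 /=.
rewrite logn_prime // eqxx expr1 /kronecker_prime dvdzE /=.
by case: ifP => // _; case: ifP => _; [case: ifP|case: existsP].
Qed.

Lemma ramifiedE d p : ramified d p <-> prime p /\ (p %| disc d)%N.
Proof. by split=> -[pp /(kronecker_prime0 _ pp)]. Qed.

Lemma squarefree_dvd (n m : nat) : (0 < n)%N -> squarefree n ->
  (forall l, prime l -> (l %| n)%N -> (l %| m)%N) -> (n %| m)%N.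
Proof.
move=> n0 sqf H; apply/dvdn_partP => // l; rewrite mem_primes => /and3P[pl _ ln].
rewrite p_part (_ : logn l n = 1%N) ?expn1; first exact: H.
apply/eqP; rewrite eqn_leq -pfactor_dvdn // expn1 ln andbT leqNgt -pfactor_dvdn //.
exact: sqf.
Qed.

Section Final.

Variables (d : nat) (eps : algC) (x y : nat).
Hypothesis d_ge2 : (2 <= d)%N.
Hypothesis d_sqf : squarefree d.
Hypothesis eps_fund : fundamental_unit d eps.
Hypothesis eps_xy : eps = x%:R + y%:R * omega d.

Local Notation sd := (sqrtC (d%:R : algC)).
Local Notation O := (quad_int d).

(** Passing from omega to half-integral coordinates turns y into Y = y or Y = 2y, hence the
    restriction to odd r. *)
Lemma eps_coord : exists X Y s0 : int, [/\ eps = halfz d X Y,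
  X ^+ 2 - d%:Z * Y ^+ 2 = 4 * s0, s0 ^+ 2 = 1 &
  forall r, prime r -> r != 2%N -> (r%:Z %| Y)%Z = (r %| y)%N].
Proof.
have [X [Y [eXY rY]]] : exists X Y : int, eps = halfz d X Y /\
    forall r, prime r -> r != 2%N -> (r%:Z %| Y)%Z = (r %| y)%N.
  rewrite eps_xy /omega; case: ifP => _.
    exists (2 * x%:Z + y%:Z), y%:Z; split; last by move=> r _ _; rewrite dvdzE.
    by rewrite /halfz !(rmorphD, rmorphM) /= -!pmulrn; field.
  exists (2 * x%:Z), (2 * y%:Z); split.
    by rewrite /halfz !rmorphM /= -!pmulrn; field.
  by move=> r pr r2; rewrite dvdzE abszM /= Euclid_dvdM // dvdn_prime2 // (negPf r2).
have ue : quad_unit d eps by have := eps_pow_unit eps_fund 1.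
have [a [b [s0 [eab e4]]]] := (quad_intP d_ge2 d_sqf _).1 ue.1.
have [EX EY] : X = a /\ Y = b by apply: (halfz_inj d_ge2 d_sqf); rewrite -eXY.
exists X, Y, s0; split=> //; first by rewrite EX EY.
have := normK_halfz d_ge2 d_sqf e4; rewrite -eab => nE.
by have [] := quad_unit_norm d_ge2 d_sqf ue; rewrite nE => n1;
  [have -> : s0 = 1 by apply: (@intr_inj rat)|have -> : s0 = -1 by apply: (@intr_inj rat)].
Qed.

(** For c = a + b sqrt d one has c^2 = 2u with u = e + d b^2 + a b sqrt d of norm 1. Since c is
    real, u is positive and so a power of eps. *)
Lemma two_norm_pow (a b e : int) : e ^+ 2 = 1 -> a ^+ 2 - d%:Z * b ^+ 2 = 2 * e ->
  exists c l, quad_field d c /\ c ^+ 2 = 2 * eps ^ l.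
Proof.
move=> e1 abe; set c := halfz d (2 * a) (2 * b).
have cK : quad_field d c by rewrite /c halfz_rat; do 2 eexists; reflexivity.
set u := halfz d (2 * (e + d%:Z * b ^+ 2)) (2 * (a * b)).
have uu : quad_unit d u.
  apply: (@halfz_unit _ _ _ 1); rewrite ?expr1n //.
  transitivity (4 * (e ^+ 2 + 2 * e * (d%:Z * b ^+ 2) + (d%:Z * b ^+ 2) ^+ 2
    - d%:Z * b ^+ 2 * (a ^+ 2 - d%:Z * b ^+ 2 + d%:Z * b ^+ 2))); first by ring.
  by rewrite abe e1; ring.
have cu : c ^+ 2 = 2 * u.
  apply: (mulfI two_neq0); rewrite expr2 /c halfzM /u.
  have -> : 2 * a * (2 * a) + d%:Z * (2 * b) * (2 * b) = 4 * (2 * (e + d%:Z * b ^+ 2)).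
    by transitivity (4 * (a ^+ 2 - d%:Z * b ^+ 2 + 2 * (d%:Z * b ^+ 2))); [ring|rewrite abe; ring].
  by rewrite /halfz !(rmorphD, rmorphXn, rmorphM) /=; field.
have u0 : 0 < u.
  have : 0 <= 2 * u by rewrite -cu -realEsqr; apply: quad_field_real cK.
  rewrite pmulr_rge0 ?ltr0n // le_eqVlt => /orP[/eqP u0|//].
  by case: uu => _ [v _ /eqP]; rewrite -u0 mul0r eq_sym oner_eq0.
by have [l ul] := pos_unit eps_fund uu u0; exists c, l; rewrite -ul.
Qed.

(** Norm -1 for eps would prevent 2 eps^l from being a square, so x^2 - 2 m y^2 = 1. For odd m and y
    this reads x^2 = 3 modulo 4. *)
Lemma y_even m p c l : d = (2 * m)%N -> odd m -> prime p -> p != 2%N -> (p %| d)%N ->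
  quad_field d c -> c ^+ 2 = 2 * eps ^ l -> (2 %| y)%N.
Proof.
move=> dm modd pp p2 pd cK ce.
have ue : quad_unit d eps by have := eps_pow_unit eps_fund 1.
have d41 : (d %% 4 == 1)%N = false by rewrite dm; clear; lia.
have eE : eps = x%:Z%:~R + y%:Z%:~R * sd by rewrite eps_xy /omega d41.
have nE : x%:Z ^+ 2 - d%:Z * y%:Z ^+ 2 = 1.
  apply: (@intr_inj rat); rewrite -(normK_coord d_ge2 d_sqf) -eE.
  have [//|n1] := quad_unit_norm d_ge2 d_sqf ue.
  have p2' : 2%N != p by rewrite eq_sym.
  by have := no_square_of_norm d_ge2 d_sqf eps_fund (isT : prime 2) pp p2' pd n1 cK ce.
rewrite dvdn2; apply/negP => yodd; move: nE; rewrite dm.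
have [w mw] : exists w : int, m%:Z = 2 * w + 1 by exists (m %/ 2)%N%:Z; move: modd; clear; lia.
have [v yv] : exists v : int, y%:Z = 2 * v + 1 by exists (y %/ 2)%N%:Z; move: yodd; clear; lia.
by rewrite PoszM mw yv; have [u [->|->]] := int_parity x%:Z; clear; lia.
Qed.

Section Iff.

Variables p q : nat.
Hypotheses (pp : prime p) (pq : prime q) (npq : p != q) (p2 : p != 2%N) (q2 : q != 2%N).
Hypotheses (pd : (p %| d)%N) (qd : (q %| d)%N).
Hypothesis d_primes : forall l, prime l -> (l %| d)%N -> [\/ l = 2%N, l = p | l = q].
Hypotheses (p_nsq : no_unit_multiple_square d eps p) (q_nsq : no_unit_multiple_square d eps q).
Hypothesis two_cases : (d %% 4 = 1)%N \/
  exists a b e : int, e ^+ 2 = 1 /\ a ^+ 2 - d%:Z * b ^+ 2 = 2 * e.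
Hypothesis y2 : (2 %| d)%N -> (2 %| y)%N.
Hypothesis h_d : Pic d O #= `I_2.

Lemma unusual_prime r r' : prime r -> r != 2%N -> (r %| d)%N -> prime r' -> r != r' ->
  (r' %| d)%N -> no_unit_multiple_square d eps r -> no_unit_multiple_square d eps r' ->
  ~~ (r %| y)%N -> unusual_conductor d r.
Proof.
move=> pr r2 rd pr' rr' r'd nr nr' ry.
have [X [Y [s0 [eXY eN s1 rY]]]] := eps_coord.
have rram : ramified d r by apply/ramifiedE; split=> //; apply: disc_dvd.
split.
- split; first exact: prime_gt0.
  by move=> l pl; apply/negP => lr; have := dvdn_trans (dvdn_mull l (dvdnn l)) lr;
    rewrite dvdn_prime2 // => /eqP lE; move: lr; rewrite lE; apply/negP/prime_sqr_ndvd.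
- by exists r.
- move=> l [pl ls]; rewrite dvdn_prime2 //; apply/eqP => lr.
  by move: ls; rewrite lr; case: rram => _ ->.
- split=> //; apply: (Pic_ramified d_ge2 d_sqf eps_fund eXY eN s1 pr r2 rd _ pr' rr' r'd nr' h_d).
  by rewrite rY.
move=> l lram; rewrite dvdn_prime2 //; last by case: lram.
by move=> /eqP -> a b; exact: (norm_condition d_ge2 eps_fund pr rd nr).
Qed.

Lemma no_unusual f : (d %| y)%N -> ~ unusual_conductor d f.
Proof.
move=> dy [[f0 f_sqf] [r rram rf] _ [_ Picf] normf].
have [X [Y [s0 [eXY eN s1 rY]]]] := eps_coord.
have [pr rdisc] := (ramifiedE d r).1 rram.
have [r2|r2] := eqVneq r 2%N.
  case: two_cases => [d41|[a [b [e [e1 abe]]]]].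
    by move: rdisc; rewrite r2 /disc d41 /= dvdn2; move: d41; clear; lia.
  have [d41|d41] := eqVneq (d %% 4)%N 1%N.
    by move: rdisc; rewrite r2 /disc d41 /= dvdn2; move: d41; clear; lia.
  (* Here d_K / 2 = 2d, so doubling a^2 - d b^2 = 2 e yields the forbidden value 4 or -4. *)
  have /negP[] := normf r rram rf a b; apply/eqP.
  rewrite r2 /disc (negPf d41); have -> : (4 * d %/ 2)%N%:Z = 2 * d%:Z by clear; lia.
  have -> : 2 * a ^+ 2 - 2 * d%:Z * b ^+ 2 = 2 * (a ^+ 2 - d%:Z * b ^+ 2) by ring.
  by rewrite abe; case: (int_sqr1 e1) => ->.
have rd : (r %| d)%N.
  move: rdisc; rewrite /disc; case: ifP => // _.
  by rewrite Euclid_dvdM // (@Euclid_dvdX 2 2) // dvdn_prime2 // (negPf r2).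
apply: (kernel_too_large d_ge2 d_sqf eps_fund eXY eN s1 pr r2 f_sqf f0 rf rd _ Picf).
by rewrite rY //; apply: dvdn_trans dy.
Qed.

(** As d is squarefree, d | y is tested prime by prime: an odd prime of d not dividing y would
    itself be an unusual conductor, and 2 is settled by [y2]. *)
Lemma unusual_iff : unusual_conductors d = set0 <-> (d %| y)%N.
Proof.
split=> [D0|dy]; last first.
  by apply/seteqP; split=> // f; apply: no_unusual.
have noD f : ~ unusual_conductor d f.
  by move=> Df; have : unusual_conductors d f by []; rewrite D0.
apply: squarefree_dvd => //; first by move: d_ge2; clear; lia.
move=> l pl ld; case: (d_primes pl ld) => lE; subst l; first exact: y2.
  by apply/negPn/negP => py; apply: (noD p); apply: (@unusual_prime p q).
apply/negPn/negP => qy; apply: (noD q).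
by apply: (@unusual_prime q p) => //; rewrite eq_sym.
Qed.

End Iff.

End Final.

Lemma pm2_square_iff d eps x y p q (e c : int) : squarefree d -> fundamental_unit d eps ->
  eps = x%:R + y%:R * omega d -> Pic d (quad_int d) #= `I_2 ->
  prime p -> prime q -> p != q -> odd p -> odd q ->
  (d = p * q \/ d = 2 * (p * q))%N -> (d %% 4 != 1)%N ->
  e ^+ 2 = 1 -> ((p * q)%N%:Z %| c ^+ 2 - 2 * e)%Z ->
  unusual_conductors d = set0 <-> (d %| y)%N.
Proof.
move=> d_sqf eps_fund eps_xy h_d pp pq npq po qo dm d41 e1 pqc.
have [p2 q2] : p != 2%N /\ q != 2%N.
  by split; [move: po|move: qo]; apply: contraTneq => ->.
have modd : odd (p * q) by rewrite oddM po.
have md : (p * q %| d)%N by case: dm => ->; [exact: dvdnn|exact: dvdn_mull].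
have d0 : (0 < d)%N.
  by have := prime_gt0 pp; have := prime_gt0 pq; case: dm => ->; rewrite !muln_gt0 => -> ->.
have [pd qd] : (p %| d)%N /\ (q %| d)%N.
  by split; apply: dvdn_trans md; [apply: dvdn_mulr|apply: dvdn_mull].
have d_ge2 : (2 <= d)%N by apply: leq_trans (dvdn_leq d0 pd); apply: prime_gt1.
have msq s : (p * q)%N <> (s ^ 2)%N.
  apply: (nonsquare_prime pp); first exact: dvdn_mulr.
  by rewrite expnS expn1 dvdn_pmul2l ?prime_gt0 // dvdn_prime2.
have [X [Z [e' [e'1 XZ]]]] := two_sqr_rep dm modd msq e1 pqc.
have [a [b [e'' [e''1 ab]]]] := two_norm d_ge2 d_sqf d41 e'1 XZ h_d.
have [g [l [gK gl]]] := two_norm_pow eps_fund e''1 ab.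
apply: (unusual_iff d_ge2 d_sqf eps_fund eps_xy pp pq npq p2 q2 pd qd) => //.
- move=> r pr rd; have : (r %| 2 * (p * q))%N.
    by apply: dvdn_trans rd _; case: dm => ->; [exact: dvdn_mull|exact: dvdnn].
  by rewrite !Euclid_dvdM // !dvdn_prime2 // => /or3P[]/eqP;
    [constructor 1|constructor 2|constructor 3].
- exact: (no_square_of_two d_ge2 d_sqf eps_fund pp pq npq p2 q2 qd gK gl).
- by apply: (no_square_of_two d_ge2 d_sqf eps_fund pq pp _ q2 p2 pd gK gl); rewrite eq_sym.
- by right; exists a, b, e''.
case: dm => dm; first by rewrite dm dvdn2 modd.
by move=> _; apply: (y_even d_ge2 d_sqf eps_fund eps_xy dm modd pp p2 pd gK gl).
Qed.

Theorem theorem2p5 (d : nat) (eps : algC) (x y : nat)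
    (d_ge2 : (2 <= d)%N)
    (d_sqf : squarefree d)
    (eps_fund : fundamental_unit d eps)
    (eps_xy : eps = x%:R + y%:R * omega d)
    (h_d : Pic d (quad_int d) #= `I_2)
    (abcd :
      [\/ (* (a) *)
          exists p q : nat,
            [/\ prime p /\ prime q, p <> q,
                p = 1 %[mod 4] /\ q = 1 %[mod 4],
                d = (p * q)%N & normK d eps = - 1],
          (* (b) *)
          exists p q : nat,
            [/\ prime p /\ prime q, p = 1 %[mod 8], q = 3 %[mod 4],
                d = (p * q)%N & odd y],
          (* (c) *)
          exists p q : nat,
            [/\ prime p /\ prime q, p <> q,
                p = 3 %[mod 8] /\ q = 3 %[mod 8] & d = (2 * p * q)%N]
        | (* (d) *)
          exists p q : nat,
            [/\ prime p /\ prime q, p = 1 %[mod 8], q = 3 %[mod 4],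
                kronecker p q = - 1 & d = (2 * p * q)%N]]) :
  unusual_conductors d = set0 <-> (d %| y)%N.

Proof.
have prime_odd p : prime p -> p != 2%N -> odd p.
  by move=> pp p2; case: (even_prime pp) => // E; rewrite E in p2.
case: abcd => [[p [q [[pp pq] /eqP npq [p4 q4] dpq Ne]]]|[p [q [[pp pq] p8 q4 dpq _]]]|
  [p [q [[pp pq] /eqP npq [p8 q8] dpq]]]|[p [q [[pp pq] p8 q4 _ dpq]]]].
- have [p2 q2] : p != 2%N /\ q != 2%N.
    by split; apply/eqP => E; [move: p4|move: q4]; rewrite E.
  have [pd qd] : (p %| d)%N /\ (q %| d)%N by rewrite dpq dvdn_mulr // dvdn_mull.
  apply: (unusual_iff d_ge2 d_sqf eps_fund eps_xy pp pq npq p2 q2 pd qd) => //.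
  + by move=> l pl; rewrite dpq Euclid_dvdM // !dvdn_prime2 // => /orP[]/eqP;
      [constructor 2|constructor 3].
  + exact: (no_square_of_norm d_ge2 d_sqf eps_fund pp pq npq qd Ne).
  + by apply: (no_square_of_norm d_ge2 d_sqf eps_fund pq pp _ pd Ne); rewrite eq_sym.
  + by left; rewrite dpq -modnMm p4 q4.
  by rewrite dpq dvdn2 oddM !prime_odd.
- have [p2 q2] : p != 2%N /\ q != 2%N.
    by split; apply/eqP => E; [move: p8|move: q4]; rewrite E.
  have npq : p != q by apply/eqP => E; move: p8 q4; rewrite E; clear; lia.
  (* The prime q dictates the sign e; since p = 1 modulo 8, both 2 and -2 are squares modulo p, so p
     can follow either sign. *)
  have [e [e1 [b qb]]] := sqrt_pm2_mod4_3 pq q4.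
  have [a pa] := sqrt_pm2_mod8_1 pp p8 e1.
  have [c pqc] := sqrt_crt pp pq npq pa qb.
  apply: (pm2_square_iff d_sqf eps_fund eps_xy h_d pp pq npq _ _ _ _ e1 pqc); rewrite ?prime_odd //.
    by left.
  have p4 : p = 1 %[mod 4] by move: p8; clear; lia.
  by rewrite dpq -modnMm p4 q4.
- have [p2 q2] : p != 2%N /\ q != 2%N.
    by split; apply/eqP => E; [move: p8|move: q8]; rewrite E.
  have sqN r : prime r -> r = 3 %[mod 8] -> exists a : int, (r%:Z %| a ^+ 2 - 2 * -1)%Z.
    by move=> pr r8; have [a ra] := sqrt_m2_mod8_3 pr r8; exists a; rewrite mulrN1 opprK.
  have [[a pa] [b qb]] := (sqN p pp p8, sqN q pq q8).
  have [c pqc] := sqrt_crt pp pq npq pa qb.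
  have N1 : (-1 : int) ^+ 2 = 1 by [].
  apply: (pm2_square_iff d_sqf eps_fund eps_xy h_d pp pq npq _ _ _ _ N1 pqc); rewrite ?prime_odd //.
    by right; rewrite mulnA.
  by rewrite dpq -mulnA; clear; lia.
have [p2 q2] : p != 2%N /\ q != 2%N.
  by split; apply/eqP => E; [move: p8|move: q4]; rewrite E.
have npq : p != q by apply/eqP => E; move: p8 q4; rewrite E; clear; lia.
have [e [e1 [b qb]]] := sqrt_pm2_mod4_3 pq q4.
have [a pa] := sqrt_pm2_mod8_1 pp p8 e1.
have [c pqc] := sqrt_crt pp pq npq pa qb.
apply: (pm2_square_iff d_sqf eps_fund eps_xy h_d pp pq npq _ _ _ _ e1 pqc); rewrite ?prime_odd //.
  by right; rewrite mulnA.
by rewrite dpq -mulnA; clear; lia.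
Qed.
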